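(* Consider the perturbed branching random walk described in the context with parameter $\theta$ satisfying $\theta_0\le\theta$ (in particular $\theta_0<\infty$), and suppose that $\mu$ has finite $r$-th moment for every $r<\theta_0/\theta$. Then \[ \frac{R_n^*}{n}\xrightarrow[n\to\infty]{\text{a.s.}} \frac{\nu(\theta_0)}{\theta_0}. \]
   Context: Branching random walk (BRW): let $\mathcal Z=\sum_{k=1}^N\delta_{\xi_k}$ be a point process on $\mathbb{R}$, where $N$ is a random variable with values in $\mathbb{N}_0$ and $\mathbb{P}(N=0)=0$. Start with one particle at $0$; at each time step every particle of the current generation dies and independently produces offspring whose positions relative to the parent are given by an independent copy of $\mathcal Z$. This yields a tree $\mathbb{T}$ with positions $S_v$, $v\in\mathbb{T}$; $|v|$ denotes the generation of $v$. Let $\nu(t)=\log\mathbb{E}\left[\sum_{i=1}^N e^{t\xi_i}\right]$, assumed finite on some open interval containing $0$, and $\nu'(t)=e^{-\nu(t)}\mathbb{E}\left[\sum_{i=1}^N\xi_ie^{t\xi_i}\right]$. The critical parameter is $\theta_0=\inf\{t>0:\nu(t)=t\nu'(t)\}$. Perturbed BRW: fix $\theta>0$; let $\{Y_v\}_{v\in\mathbb T}$ be i.i.d. positive random variables with law $\mu$ (a probability measure on $(0,\infty)$), and $\{E_v\}_{v\in\mathbb T}$ i.i.d. exponential with parameter $1$, the families $\{Y_v\}$, $\{E_v\}$ and the BRW being mutually independent. Set $S_v^*=S_v+\frac1\theta\log\frac{Y_v}{E_v}$ and $R_n^*=\sup_{|v|=n}S_v^*$. *)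

(* Defs.v *)
From HB Require Import structures.
From mathcomp Require Import all_boot all_order all_algebra.
From mathcomp Require Import all_classical all_reals all_analysis.
Set Implicit Arguments. Unset Strict Implicit. Unset Printing Implicit Defensive.
Import Order.TTheory GRing.Theory Num.Theory.
Import numFieldNormedType.Exports.
Local Open Scope classical_set_scope.
Local Open Scope ring_scope.

(** Vertices of the Ulam-Harris tree are finite words [seq nat]; the root is [::]. *)

Section BRWDefs.
Context {R : realType} {d : measure_display} {Omega : measurableType d}.

Definition gen_sigma (Z : nat -> Omega -> R) : set (set Omega) :=
  <<s [set A | exists k (B : set R), measurable B /\ A = Z k @^-1` B] >>.

Definition mutually_independent {I : eqType} (P : probability Omega R)
    (G : I -> set (set Omega)) : Prop :=
  forall (J : seq I) (A : I -> set Omega), uniq J ->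
    (forall i, i \in J -> G i (A i)) ->
    P (\bigcap_(i in [set i | i \in J]) A i) = (\prod_(i <- J) P (A i))%E.

Definition same_law (P : probability Omega R) (Z1 Z2 : nat -> Omega -> R) : Prop :=
  forall (n : nat) (B : nat -> set R), (forall k, measurable (B k)) ->
    P [set w | forall k, (k < n)%N -> B k (Z1 k w)] =
    P [set w | forall k, (k < n)%N -> B k (Z2 k w)].

(** the point process attached to vertex u, encoded as the sequence
    (N u, X u 0, X u 1, ...) ; only X u 0 .. X u (N u - 1) are offspring positions *)
Definition pp_coords (N : seq nat -> Omega -> nat) (X : seq nat -> nat -> Omega -> R)
    (u : seq nat) : nat -> Omega -> R :=
  fun k w => if k is k'.+1 then X u k' w else (N u w)%:R.

Definition in_tree (N : seq nat -> Omega -> nat) (w : Omega) (u : seq nat) : Prop :=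
  forall k, (k < size u)%N -> (nth 0%N u k < N (take k u) w)%N.

Definition position (X : seq nat -> nat -> Omega -> R) (w : Omega) (u : seq nat) : R :=
  \sum_(k < size u) X (take k u) (nth 0%N u k) w.

Definition pert_position (theta : R) (X : seq nat -> nat -> Omega -> R)
    (Y E : seq nat -> Omega -> R) (w : Omega) (u : seq nat) : R :=
  position X w u + theta^-1 * ln (Y u w / E u w).

Definition Rstar (theta : R) (N : seq nat -> Omega -> nat)
    (X : seq nat -> nat -> Omega -> R) (Y E : seq nat -> Omega -> R)
    (n : nat) (w : Omega) : R :=
  sup [set pert_position theta X Y E w u | u in [set u | in_tree N w u /\ size u = n]].

(** E[ sum_{i=1}^N e^{t xi_i} ] for the generic point process Z (the root copy) *)
Definition laplace (P : probability Omega R) (N : seq nat -> Omega -> nat)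
    (X : seq nat -> nat -> Omega -> R) (t : R) : \bar R :=
  (\int[P]_w (\sum_(i < N [::] w) expR (t * X [::] i w))%:E)%E.

Definition nu P N X (t : R) : R := ln (fine (laplace P N X t)).

Definition dlaplace (P : probability Omega R) (N : seq nat -> Omega -> nat)
    (X : seq nat -> nat -> Omega -> R) (t : R) : R :=
  fine (\int[P]_w (\sum_(i < N [::] w) X [::] i w * expR (t * X [::] i w))%:E)%E.

Definition nu' P N X (t : R) : R := expR (- nu P N X t) * dlaplace P N X t.

Definition theta0_set (P : probability Omega R) N X : set R :=
  [set t | 0 < t /\ (laplace P N X t < +oo)%E /\
     P.-integrable setT (fun w => (\sum_(i < N [::] w) X [::] i w * expR (t * X [::] i w))%:E) /\
     nu P N X t = t * nu' P N X t].

Definition theta0 P N X : R := inf (theta0_set P N X).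

End BRWDefs.

(* Main.v *)
Require Import Defs.
From HB Require Import structures.
From mathcomp Require Import all_boot all_order all_algebra.
From mathcomp Require Import all_classical all_reals all_analysis.
From mathcomp Require Import measurable_realfun zify ring lra.
Import Order.TTheory GRing.Theory Num.Theory.
Import numFieldNormedType.Exports.
Local Open Scope classical_set_scope.
Local Open Scope ring_scope.
Set Implicit Arguments.
Unset Strict Implicit.
Unset Printing Implicit Defensive.

(** Write x for nu(theta0)/theta0. As [nu] is convex, the intercept [nu s - s * nu' s] of its
    tangent at [s] is nonincreasing; it vanishes at theta0 ([theta0_mem]) and is positive below it
    ([intercept_gt0]). By continuity there are s < theta0 with nu(s)/s and nu'(s) both near x and a
    positive intercept ([near_theta0]). Both halves of the proof run at such an s.

    Upper bound. The identity exp(s S*_v) = exp(s S_v) (Y_v/E_v)^(s/theta) turns the perturbed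
    maximum into one term of an additive functional. Its mean in generation n is at most c exp(n
    nu(s)) ([integral_additive]); c is finite because s/theta < theta0/theta controls the moment of
    Y and s/theta < 1 the negative moment of E. Markov's inequality and Borel-Cantelli then bound
    all vertices of generation n at once ([pert_upper]).

    Lower bound. Keep finitely many children of each vertex and round displacements down to a finite
    grid. Let [good n u y] say that some path of length n below u climbs by at least y in this
    reduced tree and ends at a vertex with Y not small and E at most 1. Its probability dominates a
    travelling barrier om(y - a n) ([good_lower]), where om is an exponentially tilted bump of
    compact support, scaled so small that several children succeeding at once costs only a factor
    close to 1 ([good_step], [supersolution]). Such a barrier exists when the weights tilted by s
    have mean a and, relative to a, mass above 1. Fine discretisation brings a close to nu'(s) and
    the mass close to exp(nu(s) - s nu'(s)) > 1. Hence a rise of a n - K has probability bounded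
    below uniformly in n ([good_linear]).

    From positive to full probability. Follow the line of first children. The second child of each
    of its vertices, when present, starts an independent trial; outside an event of exponentially
    small probability, one of the first n/q trials succeeds ([ae_success]). The line itself falls at
    most linearly ([path_lower]), so for large q the detour costs an arbitrarily small multiple of n
    ([pert_lower]). *)

(** * A compactly supported test function and its one-step inequality *)

Section Bump.
Context {R : realType}.
Implicit Types (K C e c z : R).

(** A polynomial stand-in for the cosine eigenfunction of a centred walk killed outside the interval
    from -K to K. The double zero at the endpoints makes it continuously differentiable. *)
Definition bump K z : R := if `|z| < K then (K ^+ 2 - z ^+ 2) ^+ 2 else 0.

Lemma bump_ge0 K z : 0 <= bump K z.
Proof. by rewrite /bump; case: ifP => // _; exact: sqr_ge0. Qed.

Lemma bump_le K z : 0 <= K -> bump K z <= K ^+ 4.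
Proof.
move=> K0; rewrite /bump; case: ifPn => [|_]; last exact: exprn_ge0.
rewrite ltr_norml => /andP[zK1 zK2].
have h0 : 0 <= K ^+ 2 - z ^+ 2 by nra.
have h1 : K ^+ 2 - z ^+ 2 <= K ^+ 2 by nra.
rewrite (_ : K ^+ 4 = K ^+ 2 ^+ 2); last by rewrite -exprM.
by rewrite lerXn2r // ?nnegrE // sqr_ge0.
Qed.

(* Taylor expansion at [z]: where the quartic is convex the tangent line lies
   below, and elsewhere [bump K z] is of order [K^4] against a second-order
   term of order [K^2 C^2]. *)
Lemma bump_shift K C e c z : 0 < C -> 0 < e -> 4 * C <= K ->
  8 * C ^+ 2 <= e * K ^+ 2 -> `|c| <= C -> `|z| < K ->
  (1 - e) * bump K z + 4 * c * z * (K ^+ 2 - z ^+ 2) <= bump K (z - c).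
Proof.
move=> C0 e0 CK CeK; rewrite ler_norml => /andP[c1 c2] zK.
rewrite {1}/bump zK; move: zK; rewrite ltr_norml => /andP[z1 z2].
rewrite /bump; case: ifPn => [|].
  rewrite ltr_norml => /andP[zc1 zc2].
  have -> : (K ^+ 2 - (z - c) ^+ 2) ^+ 2 =
      (K ^+ 2 - z ^+ 2) ^+ 2 + 4 * c * z * (K ^+ 2 - z ^+ 2)
      + c ^+ 2 * (2 * z ^+ 2 + (2 * z - c) ^+ 2 - 2 * K ^+ 2) by ring.
  rewrite -subr_ge0.
  suff : 0 <= e * (K ^+ 2 - z ^+ 2) ^+ 2 +
      c ^+ 2 * (2 * z ^+ 2 + (2 * z - c) ^+ 2 - 2 * K ^+ 2) by lra.
  have K0 : 0 < K by lra.
  have [zK|zK] := lerP (K ^+ 2) (2 * z ^+ 2).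
    apply: addr_ge0; first by rewrite mulr_ge0 ?sqr_ge0// ltW.
    apply: mulr_ge0; first exact: sqr_ge0.
    have h1 : c * z <= C * K.
      apply: (le_trans (ler_norm _)); rewrite normrM ler_pM// ler_norml.
        by rewrite c1 c2.
      by rewrite !ltW.
    have h2 : 4 * C * K <= K * K by rewrite ler_wpM2r // ltW.
    have := sqr_ge0 c; nra.
  have h1 : K ^+ 2 / 2 <= K ^+ 2 - z ^+ 2 by lra.
  have h2 : (K ^+ 2 / 2) ^+ 2 <= (K ^+ 2 - z ^+ 2) ^+ 2.
    by rewrite lerXn2r // ?nnegrE; nra.
  have h3 : c ^+ 2 <= C ^+ 2 by nra.
  have h4 : c ^+ 2 * (2 * K ^+ 2) <= e * (K ^+ 2 / 2) ^+ 2.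
    have : c ^+ 2 * (2 * K ^+ 2) <= C ^+ 2 * (2 * K ^+ 2).
      by rewrite ler_wpM2r//; nra.
    have : 8 * C ^+ 2 * K ^+ 2 <= e * K ^+ 2 * K ^+ 2.
      by rewrite ler_wpM2r// sqr_ge0.
    nra.
  have h5 : 0 <= c ^+ 2 * (2 * z ^+ 2 + (2 * z - c) ^+ 2).
    by apply: mulr_ge0; [exact: sqr_ge0|apply: addr_ge0; rewrite ?sqr_ge0// mulr_ge0 ?sqr_ge0].
  have : e * (K ^+ 2 / 2) ^+ 2 <= e * (K ^+ 2 - z ^+ 2) ^+ 2 by rewrite ler_pM2l.
  nra.
move=> zc.
have d0 : 0 < K ^+ 2 - z ^+ 2 by nra.
(* Leaving the support forces [c] to point outwards against the sign of [z]: then K - |z| is at most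
   |c| while |z| is at least 3K/4, so the linear term outweighs K^2 - z^2, which is at most
   2K|c|. *)
suff : K ^+ 2 - z ^+ 2 + 4 * c * z <= 0.
  move=> h; have : (K ^+ 2 - z ^+ 2) * (K ^+ 2 - z ^+ 2 + 4 * c * z) <= 0 by nra.
  have : 0 <= e * (K ^+ 2 - z ^+ 2) ^+ 2 by rewrite mulr_ge0 ?sqr_ge0 ?ltW.
  nra.
move: zc; rewrite -leNgt ler_normr => /orP[] zc; nra.
Qed.

(* The linear term of [bump_shift] integrates to zero against the tilted
   weights [p i * expR (s * c i)], as they are centred. *)
Lemma tilted_bump_super (I : finType) (p c : I -> R) (C K s e : R) :
  (forall i, 0 <= p i) -> (forall i, `|c i| <= C) -> 0 < C -> 0 < e ->
  4 * C <= K -> 8 * C ^+ 2 <= e * K ^+ 2 ->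
  \sum_i p i * expR (s * c i) * c i = 0 ->
  1 <= (1 - e) * \sum_i p i * expR (s * c i) ->
  forall z, expR (- s * z) * bump K z <=
    \sum_i p i * (expR (- s * (z - c i)) * bump K (z - c i)).
Proof.
move=> p0 cC C0 e0 CK CeK drift mass z.
have [zK|zK] := ltP `|z| K; last first.
  rewrite {1}/bump ltNge zK/= mulr0 sumr_ge0// => i _.
  by rewrite mulr_ge0// mulr_ge0 ?expR_ge0 ?bump_ge0.
have -> : \sum_i p i * (expR (- s * (z - c i)) * bump K (z - c i)) =
    expR (- s * z) * \sum_i p i * expR (s * c i) * bump K (z - c i).
  rewrite mulr_sumr; apply: eq_bigr => i _.
  rewrite (_ : - s * (z - c i) = - s * z + s * c i); last by ring.
  by rewrite expRD; ring.
rewrite ler_pM2l ?expR_gt0//.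
apply: (@le_trans _ _ (\sum_i p i * expR (s * c i) *
   ((1 - e) * bump K z + 4 * c i * z * (K ^+ 2 - z ^+ 2)))); last first.
  apply: ler_sum => i _; rewrite ler_wpM2l ?mulr_ge0 ?expR_ge0//.
  exact: (@bump_shift K C).
have -> : \sum_i p i * expR (s * c i) *
   ((1 - e) * bump K z + 4 * c i * z * (K ^+ 2 - z ^+ 2)) =
   (1 - e) * (\sum_i p i * expR (s * c i)) * bump K z +
   (\sum_i p i * expR (s * c i) * c i) * (4 * z * (K ^+ 2 - z ^+ 2)).
  rewrite mulr_sumr !mulr_suml -big_split/=; apply: eq_bigr => i _; ring.
by rewrite drift mul0r addr0 ler_peMl ?bump_ge0.
Qed.

(** A Bonferroni bound: the second-order terms are controlled by the crude estimate size * eta of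
    the sum, so the chance of at least one success is nearly the sum of the chances. *)
Lemma prod_one_minus (I : Type) (r : seq I) (w : I -> R) (eta : R) :
  (forall i, 0 <= w i <= eta) -> (size r)%:R * eta <= 1 ->
  0 <= \prod_(i <- r) (1 - w i) <=
    1 - (1 - (size r)%:R * eta) * \sum_(i <- r) w i.
Proof.
move=> wE.
have sumE (r' : seq I) : 0 <= \sum_(i <- r') w i <= (size r')%:R * eta.
  elim: r' => [|i r' /andP[IH1 IH2]]; first by rewrite big_nil mul0r lexx.
  rewrite big_cons/= -natr1 mulrDl mul1r; have /andP[w0 w1] := wE i.
  by apply/andP; split; lra.
elim: r => [|i r IH]; first by rewrite !big_nil mulr0 subr0 lexx ler01.
rewrite !big_cons/= -natr1 => h.
have /andP[w0 w1] := wE i.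
have {sumE}/andP[S0 Sn] := sumE r.
have {IH}/andP[H1 H2] := IH ltac:(lra).
move: H1 H2 h S0 Sn; set p := \prod_(j <- r) _; set S := \sum_(j <- r) _.
move: (size r)%:R (ler0n R (size r)) => n n0 H1 H2 h S0 Sn.
have wn : w i <= 1 by nra.
apply/andP; split; first by rewrite mulr_ge0// subr_ge0.
have : (1 - w i) * p <= (1 - w i) * (1 - (1 - n * eta) * S).
  by rewrite ler_wpM2l// subr_ge0.
have : w i * ((1 - n * eta) * S) <= w i * (n * eta).
  by rewrite ler_wpM2l//; nra.
nra.
Qed.
End Bump.

(** * Independence of the sigma-algebras generated by disjoint families of marks *)

Section Independence.
Context {R : realType} {d : measure_display} {Omega : measurableType d}.
Variable P : probability Omega R.

Definition indep_events (S1 S2 : set (set Omega)) :=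
  forall A B, S1 A -> S2 B -> P (A `&` B) = (P A * P B)%E.

Lemma indep_eventsC S1 S2 : indep_events S1 S2 -> indep_events S2 S1.
Proof. by move=> h A B /[swap] SA SB; rewrite setIC h// muleC. Qed.

(** The events independent of a fixed [B] form a Dynkin system, so independence passes from a
    pi-system to the sigma-algebra it generates. *)
Lemma indep_events_gen (C : set (set Omega)) S : setI_closed C ->
  C `<=` measurable -> S `<=` measurable ->
  indep_events C S -> indep_events <<s C>> S.
Proof.
move=> CI Cm Sm CS A B CA SB; move: A CA.
have CCm : <<s C>> `<=` measurable.
  by apply: smallest_sub => //; exact: sigma_algebra_measurable.
have mB := Sm _ SB.
pose T := g_sigma_algebraType C.
apply: (@dynkin_induction _ T C (fun A : set Omega => P (A `&` B) = (P A * P B)%E)) => //.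
- by rewrite setTI probability_setT mul1e.
- by move=> A CA; exact: CS.
- move=> A mA /= AB; have {}mA : measurable (A : set Omega) by exact: CCm.
  rewrite (@setIC Omega) -setDE measureD//; last first.
    by rewrite (le_lt_trans (probability_le1 _ _)) ?ltry.
  rewrite (@setIC Omega) [X in (_ - X)%E]AB probability_setC// muleBl ?mul1e//; first exact: fin_num_measure.
- move=> F mF tF FB.
  have {}mF n : measurable (F n : set Omega) by apply: CCm; exact: mF.
  rewrite setI_bigcupl measure_bigcup//=; first last.
  + by apply: trivIset_setIr.
  + by move=> i _; exact: measurableI.
  rewrite measure_bigcup//= -(fineK (fin_num_measure P B mB)) [RHS]muleC.
  rewrite -nneseriesZl//; apply: eq_eseriesr => n _.
  by rewrite FB muleC fineK ?fin_num_measure.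
Qed.

Variables (I : eqType) (G : I -> set (set Omega)).
Hypothesis Gm : forall i, G i `<=` measurable.
Hypothesis GT : forall i, G i setT.
Hypothesis GI : forall i, setI_closed (G i).
Hypothesis Gind : mutually_independent P G.

Definition sigma_of (W : set I) : set (set Omega) :=
  <<s [set A | exists2 i, W i & G i A] >>.

Lemma sigma_of_measurable W : sigma_of W `<=` measurable.
Proof.
apply: smallest_sub; first exact: sigma_algebra_measurable.
by move=> A [i _] /Gm.
Qed.

Lemma sigma_of_gen (W : set I) i A : W i -> G i A -> sigma_of W A.
Proof. by move=> Wi GA; apply: sub_gen_smallest; exists i. Qed.

Lemma sigma_ofS W1 W2 : W1 `<=` W2 -> sigma_of W1 `<=` sigma_of W2.
Proof.
move=> W12; apply: smallest_sub; first exact: smallest_sigma_algebra.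
by move=> A [i /W12 W2i GA]; apply: sub_gen_smallest; exists i.
Qed.

(** The pi-system behind [sigma_of W], on which independence is the hypothesis [Gind] itself. [B] is
    total, with values in [G] everywhere, so that two cylinders can be merged index by index. *)
Let cylinder (W : set I) : set (set Omega) := [set A |
  exists J (B : I -> set Omega), [/\ uniq J,
    forall i, i \in J -> W i, forall i, G i (B i) &
    A = \bigcap_(i in [set i | i \in J]) B i] ].

Let cylinderI W : setI_closed (cylinder W).
Proof.
move=> _ _ [J1 [B1 [u1 W1 G1 ->]]] [J2 [B2 [u2 W2 G2 ->]]].
exists (undup (J1 ++ J2)), (fun i => (if i \in J1 then B1 i else setT) `&`
   (if i \in J2 then B2 i else setT)); split.
- exact: undup_uniq.
- by move=> i; rewrite mem_undup mem_cat => /orP[/W1|/W2].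
- by move=> i; apply: GI; case: ifP.
- apply/seteqP; split=> w.
    move=> [w1 w2] i/= _; split.
      by case: ifPn => // iJ; exact: w1.
    by case: ifPn => // iJ; exact: w2.
  move=> wJ; split => i/= iJ; have := wJ i; rewrite /= mem_undup mem_cat iJ ?orbT;
    by move=> /(_ isT)[].
Qed.

Let cylinder_measurable W : cylinder W `<=` measurable.
Proof.
move=> _ [J [B [uJ JW GB ->]]].
by apply: fin_bigcap_measurable => // i _; exact: (Gm (GB i)).
Qed.

Let cylinder_indep W1 W2 : W1 `&` W2 = set0 ->
  indep_events (cylinder W1) (cylinder W2).
Proof.
move=> W12 _ _ [J1 [B1 [u1 W1J G1 ->]]] [J2 [B2 [u2 W2J G2 ->]]].
have dis i : i \in J1 -> i \in J2 -> False.
  by move=> /W1J ? /W2J ?; suff : set0 i by []; rewrite -W12.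
have u12 : uniq (J1 ++ J2).
  rewrite cat_uniq u1 u2 andbT/=; apply/hasPn => i iJ2.
  by apply/negP => iJ1; exact: (dis i).
pose B i := if i \in J1 then B1 i else B2 i.
have -> : \bigcap_(i in [set i | i \in J1]) B1 i `&`
   \bigcap_(i in [set i | i \in J2]) B2 i = \bigcap_(i in [set i | i \in J1 ++ J2]) B i.
  apply/seteqP; split=> w.
    move=> [w1 w2] i/=; rewrite mem_cat /B; case: ifPn => [iJ1 _|_ /= iJ2].
      exact: w1.
    exact: w2.
  move=> wJ; split => i/= iJ; have := wJ i; rewrite /= mem_cat iJ ?orbT /B.
    by rewrite iJ; exact.
  by case: ifPn => [/dis/(_ iJ)//|_]; exact.
rewrite !Gind//; last first.
  by move=> i _; rewrite /B; case: ifP.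
rewrite big_cat/=; congr (_ * _)%E; apply: eq_big_seq => i iJ; rewrite /B.
  by rewrite iJ.
by case: ifPn => // /dis/(_ iJ).
Qed.

Lemma sigma_of_indep W1 W2 : W1 `&` W2 = set0 ->
  indep_events (sigma_of W1) (sigma_of W2).
Proof.
move=> W12.
have sub W : sigma_of W `<=` <<s cylinder W>>.
  apply: smallest_sub; first exact: smallest_sigma_algebra.
  move=> A [i Wi GA]; apply: sub_gen_smallest; exists [:: i], (fun j => if j == i then A else setT).
  split => //.
  - by move=> j; rewrite inE => /eqP ->.
  - by move=> j; case: eqP => [->//|_]; exact: GT.
  - apply/seteqP; split => w.
      by move=> wA j/=; rewrite inE => ->.
    by move=> /(_ i); rewrite /= mem_head eqxx; exact.
move=> A B /sub CA /sub CB.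
have CCm W : <<s cylinder W>> `<=` measurable.
  by apply: smallest_sub => //; exact: sigma_algebra_measurable.
apply: (indep_events_gen (@cylinderI W1) (@cylinder_measurable W1) (@CCm W2)) CA CB.
apply/indep_eventsC.
apply: (indep_events_gen (@cylinderI W2) (@cylinder_measurable W2)).
  exact: cylinder_measurable.
by apply/indep_eventsC/cylinder_indep.
Qed.

(** Phrased as measurability on the generated sigma-algebra, so that every closure property of
    measurable functions is at once one of adapted functions. *)
Definition adapted (W : set I) (f : Omega -> R) :=
  measurable_fun [set: g_sigma_algebraType [set A | exists2 i, W i & G i A]]
    (f : g_sigma_algebraType [set A | exists2 i, W i & G i A] -> R).

Lemma adaptedP W f : adapted W f <->
  forall B, measurable B -> sigma_of W (f @^-1` B).
Proof.
split=> [mf B mB|h _ B mB].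
  by have := mf measurableT B mB; rewrite setTI.
by rewrite setTI; exact: h.
Qed.

Lemma adapted_measurable W f : adapted W f -> measurable_fun setT f.
Proof.
move/adaptedP => h _ B mB; rewrite setTI.
by apply: (@sigma_of_measurable W); exact: h.
Qed.

Lemma adaptedS W1 W2 f : W1 `<=` W2 -> adapted W1 f -> adapted W2 f.
Proof.
by move=> W12 /adaptedP h; apply/adaptedP => B mB; apply: (sigma_ofS W12); exact: h.
Qed.

Lemma adapted_indic W A : sigma_of W A -> adapted W \1_A.
Proof. by move=> sA; exact: measurable_indic. Qed.

End Independence.

Section ExpectationProduct.
Context {R : realType} {d : measure_display} {Omega : measurableType d}.
Variable P : probability Omega R.
Local Open Scope ereal_scope.

Lemma indep_integralM (f g : Omega -> R) :
  measurable_fun setT f -> measurable_fun setT g ->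
  (forall w, (0 <= f w)%R) -> (forall w, (0 <= g w)%R) ->
  (forall A B, measurable A -> measurable B ->
     P (f @^-1` A `&` g @^-1` B) = P (f @^-1` A) * P (g @^-1` B)) ->
  \int[P]_w (f w * g w)%:E = \int[P]_w (f w)%:E * \int[P]_w (g w)%:E.
Proof.
move=> mf mg f0 g0 fg.
have mh : measurable_fun setT (fun w => (f w, g w)) by exact: measurable_fun_pair.
pose F : {mfun Omega >-> R} := HB.pack f (isMeasurableFun.Build _ _ _ _ f mf).
pose H : {mfun Omega >-> R} := HB.pack g (isMeasurableFun.Build _ _ _ _ g mg).
pose FH : {mfun Omega >-> (R * R)%type} :=
  HB.pack (fun w => (f w, g w)) (isMeasurableFun.Build _ _ _ _ _ mh).
have E X : measurable X ->
    (distribution P F \x distribution P H) X = distribution P FH X.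
  by apply: product_measure_unique => A B mA mB; exact: fg.
(* The absolute value changes nothing on the range of the pair, but makes the integrand nonnegative
   on the whole plane, as Tonelli requires. *)
have mxy : measurable_fun [set: R * R] (fun z => (`|z.1 * z.2|)%:E : \bar R).
  apply/measurable_EFinP; apply: measurableT_comp => //.
  exact: measurable_funM.
transitivity (\int[distribution P FH]_z (`|z.1 * z.2|)%:E).
  rewrite ge0_integral_distribution//.
  by apply: eq_integral => w _ /=; rewrite ger0_norm// mulr_ge0.
transitivity (\int[distribution P F \x distribution P H]_z (`|z.1 * z.2|)%:E).
  by apply: eq_measure_integral => A mA _; have /= := E _ mA.
rewrite fubini_tonelli1//.
rewrite /fubini_F/=.
transitivity (\int[distribution P F]_x ((`|x|)%:E * \int[P]_w (g w)%:E)).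
  apply: eq_integral => x _.
  rewrite ge0_integral_distribution//; last first.
    by apply/measurable_EFinP; apply: measurableT_comp => //; exact: measurable_funM.
  rewrite -ge0_integralZl//; last 2 first.
  - by apply/measurable_EFinP.
  - by move=> w _; rewrite lee_fin.
  apply: eq_integral => w _ /=.
  by rewrite -EFinM normrM (ger0_norm (g0 w)).
rewrite ge0_integral_distribution//; last 2 first.
- apply: emeasurable_funM; last exact: measurable_cst.
  by apply/measurable_EFinP; exact: normr_measurable.
- by move=> x; rewrite mule_ge0// ?lee_fin// integral_ge0// => w _; rewrite lee_fin.
rewrite -ge0_integralZr//.
- by apply: eq_integral => w _ /=; rewrite ger0_norm.
- exact/measurable_EFinP.
- by move=> w _; rewrite lee_fin.
- by apply: integral_ge0 => w _; rewrite lee_fin.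
Qed.

End ExpectationProduct.

(** * Sums with a random number of terms, and real-valued dominated convergence *)

Section RandomSums.
Context {R : realType} {d : measure_display} {T : measurableType d}.
Implicit Types (n : T -> nat) (f : nat -> T -> R).

Lemma random_sum_cvg n f w :
  (fun m => \sum_(i < m) ((i < n w)%N%:R * f i w)) @ \oo --> \sum_(i < n w) f i w.
Proof.
apply: cvg_near_cst; near=> m.
have nm : (n w <= m)%N by near: m; exact: nbhs_infty_ge.
rewrite (big_ord_widen _ (f ^~ w) nm) [RHS]big_mkcond/=; apply: eq_bigr => i _.
by case: ifP => _; rewrite ?mul1r ?mul0r.
Unshelve. all: by end_near. Qed.

Lemma measurable_nat_lt n i : measurable_fun setT n ->
  measurable_fun setT (fun w => ((i < n w)%N%:R : R)).
Proof.
move=> mn; rewrite (_ : (fun w => _) = \1_[set w | (i < n w)%N]); last first.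
  apply/funext => w; rewrite indicE; congr (_%:R); congr nat_of_bool.
  by apply/idP/idP; rewrite inE.
apply: measurable_indic; rewrite -[X in measurable X]setTI.
exact: (mn measurableT [set k | (i < k)%N]).
Qed.

Lemma measurable_random_sum n f : measurable_fun setT n ->
  (forall i, measurable_fun setT (f i)) ->
  measurable_fun setT (fun w => \sum_(i < n w) f i w).
Proof.
move=> mn mf.
apply: (@measurable_fun_cvg _ _ _ _ (fun m w => \sum_(i < m) ((i < n w)%N%:R * f i w))).
  move=> m; apply: measurable_sum => i; apply: measurable_funM => //.
  exact: measurable_nat_lt.
by move=> w _; exact: random_sum_cvg.
Qed.

Lemma integral_random_sum (mu : {measure set T -> \bar R}) n f :
  measurable_fun setT n -> (forall i, measurable_fun setT (f i)) ->
  (forall i w, 0 <= f i w) ->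
  (\int[mu]_w (\sum_(i < n w) f i w)%:E =
   \sum_(i <oo) \int[mu]_w ((i < n w)%N%:R * f i w)%:E)%E.
Proof.
move=> mn mf f0; rewrite -integral_nneseries//; last 2 first.
- move=> i; apply/measurable_EFinP; apply: measurable_funM => //.
  exact: measurable_nat_lt.
- by move=> i w _; rewrite lee_fin mulr_ge0.
apply: eq_integral => w _; apply/esym/cvg_lim => //.
under eq_cvg do rewrite sumEFin big_mkord.
by apply/cvg_EFin; [exact: nearW|exact: random_sum_cvg].
Qed.

End RandomSums.

Section RealDominated.
Context {R : realType} {d : measure_display} {T : measurableType d}.
Variable mu : {measure set T -> \bar R}.

Lemma real_dominated_cvg (f_ : nat -> T -> R) (f g : T -> R) :
  (forall n, measurable_fun setT (f_ n)) -> measurable_fun setT f ->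
  (forall w, f_ ^~ w @ \oo --> f w) ->
  mu.-integrable setT (EFin \o g) -> (forall n w, `|f_ n w| <= g w) ->
  mu.-integrable setT (EFin \o f) /\
  (fun n => \int[mu]_w f_ n w) @ \oo --> \int[mu]_w f w.
Proof.
move=> mf_ mf f_f ig f_g.
have [||||| If _ cI] := @dominated_convergence _ _ _ mu setT measurableT
  (fun n => EFin \o f_ n) (EFin \o f) (EFin \o g).
- by move=> n; exact/measurable_EFinP.
- exact/measurable_EFinP.
- apply: aeW => w _; apply/cvg_EFin; [exact: nearW|exact: f_f].
- exact: ig.
- by apply: aeW => w n _; rewrite lee_fin.
split=> //; apply: fine_cvg; rewrite /Rintegral fineK//.
exact: integrable_fin_num.
Qed.

Lemma real_le_integrable (f g : T -> R) : measurable_fun setT f ->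
  (forall w, `|f w| <= g w) -> mu.-integrable setT (EFin \o g) ->
  mu.-integrable setT (EFin \o f).
Proof.
move=> mf fg; apply: le_integrable => //; first exact/measurable_EFinP.
by move=> w _ /=; rewrite lee_fin (le_trans (fg w))// ler_norm.
Qed.

Lemma ge0_integrableP (f : T -> R) : measurable_fun setT f ->
  (forall w, 0 <= f w) -> (\int[mu]_w (f w)%:E < +oo)%E <->
  mu.-integrable setT (EFin \o f).
Proof.
move=> mf f0; have E : (\int[mu]_w `|(f w)%:E| = \int[mu]_w (f w)%:E)%E.
  by apply: eq_integral => w _; rewrite gee0_abs// lee_fin.
split=> [foo|/integrableP[_]]; last by rewrite E.
by apply/integrableP; split; [exact/measurable_EFinP|rewrite E].
Qed.

End RealDominated.

(** * Integrability of exponential statistics of the offspring point process *)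

Section ExpBounds.
Context {R : realType}.
Implicit Types s t y : R.

(** Multiply 1 - s y <= exp(- s y) by exp(s y). It bounds |y| exp(s y) on the negative half-line, so
    that integrability only has to be checked for positive displacements. *)
Lemma neg_mul_expR_le s y : 0 < s -> - y * expR (s * y) <= s^-1.
Proof.
move=> s0; rewrite -(@ler_pM2l _ s)// divff ?gt_eqF//.
have := expR_ge1Dx (- (s * y)).
have := expRxMexpNx_1 (s * y); have := expR_gt0 (s * y).
set u := expR (s * y); set v := expR _ => u0 uv h.
have : u * (1 + - (s * y)) <= u * v by rewrite ler_pM2l.
nra.
Qed.

Lemma abs_expR_le s t y : 0 < s -> s <= t ->
  `|y| * expR (s * y) <= `|y| * expR (t * y) + s^-1.
Proof.
move=> s0 st; have [y0|y0] := leP 0 y.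
  rewrite ger0_norm// (@le_trans _ _ (y * expR (t * y)))//.
    by rewrite ler_wpM2l// ler_expR ler_wpM2r.
  by rewrite lerDl invr_ge0 ltW.
rewrite ltr0_norm// (le_trans (neg_mul_expR_le y s0))// lerDr mulr_ge0 ?expR_ge0//.
by rewrite oppr_ge0 ltW.
Qed.

Lemma expR_le_between s t y : 0 <= s -> s <= t -> expR (s * y) <= expR (t * y) + 1.
Proof.
move=> s0 st; have [y0|y0] := leP 0 y.
  by rewrite (@le_trans _ _ (expR (t * y)))// ?lerDl// ler_expR ler_wpM2r.
rewrite (@le_trans _ _ 1)// ?lerDr ?expR_ge0// -expR0 ler_expR.
by rewrite mulr_ge0_le0// ltW.
Qed.

(** [theta0_set] asks for integrability of the signed sum only; this majorant upgrades it to
    absolute values, at the price of a constant per child. *)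
Lemma abs_expR_le_signed t y : 0 < t ->
  `|y| * expR (t * y) <= y * expR (t * y) + t^-1 + t^-1.
Proof.
move=> t0; have ti : 0 <= t^-1 by rewrite invr_ge0 ltW.
have [y0|y0] := leP 0 y; first by rewrite ger0_norm// -addrA lerDl addr_ge0.
by rewrite ltr0_norm//; have := neg_mul_expR_le y t0; lra.
Qed.

End ExpBounds.

Section Laplace.
Context {R : realType} {d : measure_display} {Omega : measurableType d}.
Variables (P : probability Omega R) (N : seq nat -> Omega -> nat)
  (X : seq nat -> nat -> Omega -> R).
Hypothesis mN : measurable_fun setT (N [::]).
Hypothesis mX : forall k, measurable_fun setT (X [::] k).

Implicit Types phi psi : R -> R.

(** A linear statistic of the root point process. Inequalities between functions on the line pass to
    it, so domination arguments reduce to functions of one real variable. *)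
Definition psum (phi : R -> R) (w : Omega) : R :=
  \sum_(i < N [::] w) phi (X [::] i w).

Lemma measurable_psum phi : measurable_fun setT phi -> measurable_fun setT (psum phi).
Proof.
move=> mphi; apply: (measurable_random_sum (f := fun i w => phi (X [::] i w))) => // i.
exact: measurableT_comp.
Qed.

Lemma psumD phi psi : psum (fun y => phi y + psi y) = psum phi \+ psum psi.
Proof. by apply/funext => w /=; rewrite /psum big_split. Qed.

Lemma psumZ (c : R) phi : psum (fun y => c * phi y) = fun w => c * psum phi w.
Proof. by apply/funext => w /=; rewrite /psum mulr_sumr. Qed.

Lemma psum_le phi psi w : (forall y, phi y <= psi y) -> psum phi w <= psum psi w.
Proof. by move=> h; apply: ler_sum. Qed.

Lemma psum_abs phi psi w : (forall y, `|phi y| <= psi y) -> `|psum phi w| <= psum psi w.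
Proof.
by move=> h; rewrite (le_trans (ler_norm_sum _ _ _))//; exact: ler_sum.
Qed.

Definition psum_integrable (phi : R -> R) :=
  measurable_fun setT phi /\ P.-integrable setT (EFin \o psum phi).

Lemma psum_integrable_le phi psi : measurable_fun setT phi ->
  (forall y, `|phi y| <= psi y) -> psum_integrable psi -> psum_integrable phi.
Proof.
move=> mphi h [mpsi ipsi]; split => //.
apply: real_le_integrable ipsi; first exact: measurable_psum.
by move=> w; exact: psum_abs.
Qed.

Lemma psum_integrableD phi psi : psum_integrable phi -> psum_integrable psi ->
  psum_integrable (fun y => phi y + psi y).
Proof.
move=> [mphi iphi] [mpsi ipsi]; split; first exact: measurable_funD.
by rewrite psumD; apply: eq_integrable (integrableD _ iphi ipsi).
Qed.

Lemma psum_integrableZ (c : R) phi : psum_integrable phi ->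
  psum_integrable (fun y => c * phi y).
Proof.
move=> [mphi iphi]; split; first exact: measurable_funM.
by rewrite psumZ; apply: eq_integrable (integrableZl _ c iphi).
Qed.

Lemma RintegralDZ phi psi (a b : R) : psum_integrable phi -> psum_integrable psi ->
  \int[P]_w psum (fun y => a * phi y + b * psi y) w =
  a * \int[P]_w psum phi w + b * \int[P]_w psum psi w.
Proof.
move=> iphi ipsi; rewrite psumD RintegralD//; last 2 first.
- by have [] := psum_integrableZ a iphi.
- by have [] := psum_integrableZ b ipsi.
by rewrite !psumZ !RintegralZl//; [case: ipsi|case: iphi].
Qed.

Lemma le_Rintegral_psum phi psi : psum_integrable phi -> psum_integrable psi ->
  (forall y, phi y <= psi y) -> \int[P]_w psum phi w <= \int[P]_w psum psi w.
Proof.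
by move=> [_ iphi] [_ ipsi] h; apply: le_Rintegral => // w _; exact: psum_le.
Qed.

Lemma psum_dominated_cvg (phi_ : nat -> R -> R) phi psi :
  (forall n, measurable_fun setT (phi_ n)) -> measurable_fun setT phi ->
  (forall y, phi_ ^~ y @ \oo --> phi y) -> psum_integrable psi ->
  (forall n y, `|phi_ n y| <= psi y) ->
  (fun n => \int[P]_w psum (phi_ n) w) @ \oo --> \int[P]_w psum phi w.
Proof.
move=> mphi_ mphi cphi [mpsi ipsi] phi_psi.
apply: (real_dominated_cvg (g := psum psi) _ _ _ ipsi _).2.
- by move=> n; exact: measurable_psum.
- exact: measurable_psum.
- move=> w; apply: cvg_big => [|i _]; [exact: add_continuous|exact: cphi].
- by move=> n w; exact: psum_abs.
Qed.

Lemma measurable_expRM s : measurable_fun setT (fun y : R => expR (s * y)).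
Proof. by apply: measurableT_comp => //; exact: measurable_funM. Qed.

Lemma measurable_absM s : measurable_fun setT (fun y : R => `|y| * expR (s * y)).
Proof.
by apply: measurable_funM; [exact: normr_measurable|exact: measurable_expRM].
Qed.

Lemma measurable_idM s : measurable_fun setT (fun y : R => y * expR (s * y)).
Proof. by apply: measurable_funM => //; exact: measurable_expRM. Qed.

Lemma laplaceE t : (laplace P N X t < +oo)%E <->
  psum_integrable (fun y => expR (t * y)).
Proof.
have := @ge0_integrableP R d Omega P (psum (fun y => expR (t * y))) _ _.
move=> /(_ (measurable_psum (measurable_expRM t))) H.
rewrite /laplace; split=> [Lt|[_ Lt]]; last first.
  by apply H => // w; apply: sumr_ge0 => i _; exact: expR_ge0.
split; first exact: measurable_expRM.
by apply H => // w; apply: sumr_ge0 => i _; exact: expR_ge0.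
Qed.

End Laplace.

(** * Convexity and continuity of nu *)

Section Nu.
Context {R : realType} {d : measure_display} {Omega : measurableType d}.
Variables (P : probability Omega R) (N : seq nat -> Omega -> nat)
  (X : seq nat -> nat -> Omega -> R).
Hypothesis mN : measurable_fun setT (N [::]).
Hypothesis mX : forall k, measurable_fun setT (X [::] k).
Hypothesis N_gt0 : P [set w | N [::] w = 0%N] = 0%E.
Hypothesis laplace0 : (laplace P N X 0 < +oo)%E.

Local Notation pint := (psum_integrable P N X).
Local Notation A s := (fine (laplace P N X s)).
Local Notation D := (dlaplace P N X).

(** The statistic of a constant is a multiple of the offspring number, whose mean is the transform
    at 0. *)
Lemma pint_cst (c : R) : pint (fun _ => c).
Proof.
have /(laplaceE P mN mX) := laplace0.
move=> /(psum_integrableZ c); congr psum_integrable.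
by apply/funext => y /=; rewrite mul0r expR0 mulr1.
Qed.

(** A zero integral would force an empty sum, that is no children, almost surely. Positivity keeps
    [ln] in the definition of [nu] away from its default value. *)
Lemma laplace_gt0 s : pint (fun y => expR (s * y)) -> 0 < A s.
Proof.
move=> [me ie]; rewrite lt_neqAle; apply/andP; split; last first.
  by apply: fine_ge0; apply: integral_ge0 => w _; rewrite lee_fin sumr_ge0// => i _; exact: expR_ge0.
apply/negP => /eqP/esym A0.
have /ae_eq_integral_abs : (\int[P]_w `|(EFin \o psum N X (fun y => expR (s * y))) w| = 0)%E.
  transitivity (laplace P N X s).
    apply: eq_integral => w _; rewrite gee0_abs// lee_fin sumr_ge0// => i _; exact: expR_ge0.
  rewrite -[LHS]fineK; first by rewrite A0.
  by apply: integrable_fin_num => //; exact: ie.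
move=> /(_ measurableT (measurable_int _ ie))[B [mB PB sub]].
have mN0 : measurable [set w | N [::] w = 0%N].
  have -> : [set w | N [::] w = 0%N] = N [::] @^-1` [set 0%N] by [].
  by rewrite -[X in measurable X]setTI; apply: mN.
have : P (B `|` [set w | N [::] w = 0%N]) = 0%E.
  by apply: null_set_setU.
have -> : B `|` [set w | N [::] w = 0%N] = setT.
  apply/seteqP; split => // w _.
  have [Nw|Nw] := pselect (N [::] w = 0%N); [by right|left].
  apply: sub => /= /(_ Logic.I) [] /eqP; rewrite /psum psumr_eq0; last by move=> i _; exact: expR_ge0.
  have Nw0 : (0 < N [::] w)%N by rewrite lt0n; exact/eqP.
  by move=> /allP /(_ (Ordinal Nw0)); rewrite mem_index_enum => /(_ isT); rewrite gt_eqF// expR_gt0.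
by rewrite probability_setT => /eqP; rewrite onee_eq0.
Qed.

Lemma expR_nu s : pint (fun y => expR (s * y)) -> expR (nu P N X s) = A s.
Proof. by move=> /laplace_gt0 A0; rewrite /nu lnK. Qed.

Lemma nu'E s : pint (fun y => expR (s * y)) -> nu' P N X s = D s / A s.
Proof. by move=> h; rewrite /nu' expRN expR_nu// mulrC. Qed.

(* Jensen's inequality for the law tilted by [expR (s * y)]. *)
Lemma nu_tangent s t : pint (fun y => expR (s * y)) ->
  pint (fun y => y * expR (s * y)) -> pint (fun y => expR (t * y)) ->
  nu P N X s + (t - s) * nu' P N X s <= nu P N X t.
Proof.
move=> is_ ds it; rewrite -ler_expR expRD !expR_nu// nu'E//.
have A0 := laplace_gt0 is_; set m := (t - s) * _.
(* [m] is the mean of (t - s) y under the tilted law, so the bracket equals [A s]. The inequality is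
   exp(z) >= exp(m) (1 + z - m) at z = (t - s) y, integrated against the tilted weights. *)
suff : expR m * ((1 - m) * A s + (t - s) * D s) <= A t.
  rewrite (_ : (1 - m) * A s + (t - s) * D s = A s); first by rewrite mulrC.
  by rewrite /m; field; rewrite gt_eqF.
rewrite mulrDr !mulrA -[A s]/(\int[P]_w psum N X (fun y => expR (s * y)) w).
rewrite -[D s]/(\int[P]_w psum N X (fun y => y * expR (s * y)) w).
rewrite -RintegralDZ//.
apply: (@le_Rintegral_psum _ _ _ P N X _ (fun y => expR (t * y))) => //.
  by apply: psum_integrableD => //; exact: psum_integrableZ.
move=> y /=; have -> : expR (t * y) = expR m * expR (s * y) * expR ((t - s) * y - m).
  by rewrite -!expRD; congr expR; ring.
apply: (@le_trans _ _ (expR m * expR (s * y) * (1 + ((t - s) * y - m)))); last first.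
  by rewrite ler_wpM2l ?expR_ge1Dx// mulr_ge0 ?expR_ge0.
by rewrite le_eqVlt; apply/orP; left; apply/eqP; ring.
Qed.

Variable t1 : R.
Hypothesis t1S : theta0_set P N X t1.

Let t1_gt0 : 0 < t1. Proof. by case: t1S. Qed.

Lemma pint_exp s : 0 <= s -> s <= t1 -> pint (fun y => expR (s * y)).
Proof.
move=> s0 st1; have [_ [/(laplaceE P mN mX) Lt _]] := t1S.
apply: (psum_integrable_le mN mX (psi := fun y => expR (t1 * y) + 1)) => //.
- exact: measurable_expRM.
- by move=> y; rewrite ger0_norm ?expR_ge0//; exact: expR_le_between.
- by apply: psum_integrableD => //; exact: pint_cst.
Qed.

Lemma pint_abs1 : pint (fun y => `|y| * expR (t1 * y)).
Proof.
have [_ [_ [i1 _]]] := t1S.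
apply: (psum_integrable_le mN mX (psi := fun y => y * expR (t1 * y) + (t1^-1 + t1^-1))) => //.
- exact: measurable_absM.
- move=> y; rewrite ger0_norm ?mulr_ge0 ?expR_ge0// addrA.
  exact: abs_expR_le_signed.
- by apply: psum_integrableD => //; [split => //; exact: measurable_idM|exact: pint_cst].
Qed.

Lemma pint_abs s : 0 < s -> s <= t1 -> pint (fun y => `|y| * expR (s * y)).
Proof.
move=> s0 st1.
apply: (psum_integrable_le mN mX (psi := fun y => `|y| * expR (t1 * y) + s^-1)) => //.
- exact: measurable_absM.
- by move=> y; rewrite ger0_norm ?mulr_ge0 ?expR_ge0//; exact: abs_expR_le.
- by apply: psum_integrableD => //; [exact: pint_abs1|exact: pint_cst].
Qed.

Lemma pint_id s : 0 < s -> s <= t1 -> pint (fun y => y * expR (s * y)).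
Proof.
move=> s0 st1.
apply: (psum_integrable_le mN mX (psi := fun y => `|y| * expR (s * y))) => //.
- exact: measurable_idM.
- by move=> y; rewrite normrM (ger0_norm (expR_ge0 _)).
- exact: pint_abs.
Qed.

Local Notation intercept s := (nu P N X s - s * nu' P N X s).

(** Evaluating the tangent at each point at the other one orders the slopes; the tangent at [t]
    evaluated at [s] then compares the intercepts. *)
Lemma intercept_nonincreasing s t : 0 < s -> s <= t -> t <= t1 ->
  intercept t <= intercept s.
Proof.
move=> s0; rewrite le_eqVlt => /orP[/eqP->//|lst] tt1; have st := ltW lst.
have t0 := lt_le_trans s0 st; have st1 := le_trans st tt1.
have := nu_tangent (pint_exp (ltW s0) st1) (pint_id s0 st1) (pint_exp (ltW t0) tt1).
have := nu_tangent (pint_exp (ltW t0) tt1) (pint_id t0 tt1) (pint_exp (ltW s0) st1).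
move: (nu P N X s) (nu P N X t) (nu' P N X s) (nu' P N X t) => a b a' b' h2 h1.
have {}st : 0 < t - s by rewrite subr_gt0.
have : a' <= b' by rewrite -(ler_pM2l st); lra.
by move=> /(ler_wpM2l (ltW s0)); lra.
Qed.

Lemma intercept_ge0 s : 0 < s -> s <= t1 -> 0 <= intercept s.
Proof.
move=> s0 st; have := intercept_nonincreasing s0 st (lexx _).
by have [_ [_ [_ ->]]] := t1S; rewrite subrr.
Qed.

Lemma intercept_eq0 s : 0 < s -> s <= t1 -> intercept s = 0 -> theta0_set P N X s.
Proof.
move=> s0 st /eqP; rewrite subr_eq0 => /eqP E; split => //; split.
  by apply/(laplaceE P mN mX); apply: pint_exp => //; exact: ltW.
by split => //; have [_] := pint_id s0 st.
Qed.

(** Dominated convergence. The sequence stays below [t1], where the majorants live since nothing is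
    assumed beyond [t1], and above s/2, which bounds the contribution of negative displacements. *)
Lemma nu_cvg (u : nat -> R) s : u @ \oo --> s -> 0 < s -> s <= t1 ->
  (forall n, s / 2 <= u n <= t1) ->
  (fun n => nu P N X (u n)) @ \oo --> nu P N X s /\
  (fun n => nu' P N X (u n)) @ \oo --> nu' P N X s.
Proof.
move=> us s0 st un.
have s20 : 0 < s / 2 by rewrite divr_gt0.
have cA : (fun n => \int[P]_w psum N X (fun y => expR (u n * y)) w) @ \oo -->
    \int[P]_w psum N X (fun y => expR (s * y)) w.
  apply: (psum_dominated_cvg mN mX (phi_ := fun n y => expR (u n * y))
      (psi := fun y => expR (t1 * y) + 1)).
  - by move=> n; exact: measurable_expRM.
  - exact: measurable_expRM.
  - move=> y; apply: (@continuous_cvg _ _ _ _ _ _ (expR : R -> R)); first exact: continuous_expR.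
    by apply: cvgMl.
  - by apply: psum_integrableD => //; [apply: pint_exp => //; exact: ltW|exact: pint_cst].
  - move=> n y; rewrite ger0_norm ?expR_ge0//; have /andP[? ?] := un n.
    by apply: expR_le_between => //; lra.
have cD : (fun n => \int[P]_w psum N X (fun y => y * expR (u n * y)) w) @ \oo -->
    \int[P]_w psum N X (fun y => y * expR (s * y)) w.
  apply: (psum_dominated_cvg mN mX (phi_ := fun n y => y * expR (u n * y))
      (psi := fun y => `|y| * expR (t1 * y) + (s / 2)^-1)).
  - by move=> n; exact: measurable_idM.
  - exact: measurable_idM.
  - move=> y; apply: cvgMr.
    apply: (@continuous_cvg _ _ _ _ _ _ (expR : R -> R)); first exact: continuous_expR.
    by apply: cvgMl.
  - by apply: psum_integrableD => //; [exact: pint_abs1|exact: pint_cst].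
  - move=> n y; rewrite normrM (ger0_norm (expR_ge0 _)); have /andP[u1 u2] := un n.
    apply: (le_trans (abs_expR_le y _ u2)); first by lra.
    by rewrite lerD2l lef_pV2 ?posrE//; lra.
have As0 : 0 < A s by apply: laplace_gt0; apply: pint_exp => //; exact: ltW.
split.
  have E r : nu P N X r = ln (\int[P]_w psum N X (fun y => expR (r * y)) w) by [].
  under eq_fun do rewrite E.
  by rewrite E; apply: (cvg_comp _ _ cA); exact: continuous_ln.
have -> : (fun n => nu' P N X (u n)) =
    (fun n => \int[P]_w psum N X (fun y => y * expR (u n * y)) w /
              \int[P]_w psum N X (fun y => expR (u n * y)) w).
  apply/funext => n; rewrite nu'E//; have /andP[? ?] := un n.
  by apply: pint_exp => //; lra.
rewrite nu'E; last by apply: pint_exp => //; exact: ltW.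
by apply: cvgM => //; apply: cvgV => //; rewrite gt_eqF.
Qed.

End Nu.

(** * The critical parameter and parameters slightly below it *)

Section Theta0.
Context {R : realType} {d : measure_display} {Omega : measurableType d}.
Variables (P : probability Omega R) (N : seq nat -> Omega -> nat)
  (X : seq nat -> nat -> Omega -> R).
Hypothesis mN : measurable_fun setT (N [::]).
Hypothesis mX : forall k, measurable_fun setT (X [::] k).
Hypothesis N_gt0 : P [set w | N [::] w = 0%N] = 0%E.
Hypothesis laplace0 : (laplace P N X 0 < +oo)%E.
Hypothesis set_neq0 : theta0_set P N X !=set0.
Hypothesis theta0_gt0 : 0 < theta0 P N X.

Local Notation theta0 := (theta0 P N X).
Local Notation S := (theta0_set P N X).
Local Notation intercept s := (nu P N X s - s * nu' P N X s).

Let S_lb : has_lbound S.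
Proof. by exists 0 => s [s0 _]; exact: ltW. Qed.

Lemma theta0_le s : S s -> theta0 <= s.
Proof. by move=> Ss; exact: ge_inf. Qed.

Lemma intercept_set s : S s -> intercept s = 0.
Proof. by move=> [_ [_ [_ ->]]]; rewrite subrr. Qed.

(* The intercept at 0 of the tangent to [nu] is nonincreasing and vanishes on
   the set defining [theta0], hence immediately to the right of its infimum. *)
Lemma theta0_mem : S theta0.
Proof.
have [t1 t1S] := set_neq0.
have := theta0_le t1S; rewrite le_eqVlt => /orP[/eqP->//|t01].
have right0 t : theta0 < t -> t <= t1 -> intercept t = 0.
  move=> t0t tt1; apply/eqP; rewrite eq_le.
  have t_gt0 := lt_trans theta0_gt0 t0t.
  rewrite (intercept_ge0 mN mX N_gt0 laplace0 t1S)// andbT.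
  have [u uS ut] := inf_lt set_neq0 t0t.
  have u0 : 0 < u by case: uS.
  rewrite -(intercept_set uS).
  exact: (intercept_nonincreasing mN mX N_gt0 laplace0 t1S u0 (ltW ut) tt1).
pose u (n : nat) := theta0 + (t1 - theta0) * n.+1%:R^-1.
have d0 : 0 < t1 - theta0 by rewrite subr_gt0.
have un n : theta0 < u n <= t1.
  rewrite /u ltrDl mulr_gt0 ?invr_gt0//= -lerBrDl ger_pMr// invf_le1//.
  by rewrite ler1n.
have cu : u @ \oo --> theta0.
  rewrite -[X in _ --> X]addr0; apply: cvgD; first exact: cvg_cst.
  rewrite -[X in _ --> X](mulr0 (t1 - theta0)); apply: cvgM; first exact: cvg_cst.
  exact: cvg_harmonic.
have [cnu cnu'] : (fun n => nu P N X (u n)) @ \oo --> nu P N X theta0 /\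
    (fun n => nu' P N X (u n)) @ \oo --> nu' P N X theta0.
  apply: (nu_cvg mN mX N_gt0 laplace0 t1S cu) => // [|n]; first exact: ltW.
  have /andP[u1 ->] := un n; rewrite andbT (le_trans _ (ltW u1))//.
  by rewrite ler_pdivrMr// ler_peMr ?ler1n// ltW.
apply: (intercept_eq0 mN mX laplace0 t1S) => //; first exact: ltW.
have : (fun n => intercept (u n)) @ \oo --> intercept theta0.
  by apply: cvgB => //; exact: cvgM.
have -> : (fun n => intercept (u n)) = (fun=> 0).
  by apply/funext => n; have /andP[u1 u2] := un n; exact: right0.
by move=> /(cvg_unique _ (cvg_cst 0)) <-.
Qed.

(** A zero of the intercept would belong to [theta0_set], below its infimum. *)
Lemma intercept_gt0 s : 0 < s -> s < theta0 -> 0 < intercept s.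
Proof.
move=> s0 st; rewrite lt_neqAle.
rewrite (intercept_ge0 mN mX N_gt0 laplace0 theta0_mem s0 (ltW st)) andbT.
apply/negP => /eqP /esym/(intercept_eq0 mN mX laplace0 theta0_mem s0 (ltW st)).
by move=> /theta0_le; rewrite leNgt st.
Qed.

(** At theta0 the tangent passes through the origin, so nu(s)/s and nu'(s) have the same limit
    there. The first controls the upper bound, the second the lower bound, and the positive
    intercept supplies the growth that the lower bound lives on. *)
Lemma near_theta0 e : 0 < e -> exists s, [/\ 0 < s < theta0,
  nu P N X s / s < nu P N X theta0 / theta0 + e,
  nu P N X theta0 / theta0 - e < nu' P N X s & 0 < intercept s].
Proof.
move=> e0; pose u (n : nat) := theta0 - (theta0 / 2) * n.+1%:R^-1.
have h0 : 0 < theta0 / 2 by rewrite divr_gt0.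
have un n : theta0 / 2 <= u n < theta0.
  rewrite /u ltrBlDr ltrDl mulr_gt0 ?invr_gt0// andbT.
  rewrite lerBrDr -lerBrDl [leRHS](_ : _ = theta0 / 2); last by field.
  by rewrite ger_pMr// invf_le1// ler1n.
have cu : u @ \oo --> theta0.
  rewrite -[X in _ --> X]subr0; apply: cvgB; first exact: cvg_cst.
  rewrite -[X in _ --> X](mulr0 (theta0 / 2)); apply: cvgM; first exact: cvg_cst.
  exact: cvg_harmonic.
have [cnu cnu'] : (fun n => nu P N X (u n)) @ \oo --> nu P N X theta0 /\
    (fun n => nu' P N X (u n)) @ \oo --> nu' P N X theta0.
  apply: (nu_cvg mN mX N_gt0 laplace0 theta0_mem cu) => // n.
  by have /andP[-> /ltW ->] := un n.
have xE : nu' P N X theta0 = nu P N X theta0 / theta0.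
  have [_ [_ [_ ->]]] := theta0_mem.
  by rewrite mulrAC divff ?mul1r// gt_eqF.
rewrite xE in cnu'.
have cdiv : (fun n => nu P N X (u n) / u n) @ \oo --> nu P N X theta0 / theta0.
  by apply: cvgM => //; apply: cvgV => //; rewrite gt_eqF.
have H1 := cvgr_lt _ cdiv (nu P N X theta0 / theta0 + e) ltac:(by rewrite ltrDl).
have H2 := cvgr_gt _ cnu' (nu P N X theta0 / theta0 - e) ltac:(by rewrite ltrBlDr ltrDl).
have [n [Hn1 Hn2]] := filter_ex (filterI (H1 _) (H2 _)).
have /andP[u1 u2] := un n; have u0 := lt_le_trans h0 u1.
by exists (u n); split => //; [rewrite u0|exact: intercept_gt0].
Qed.

(** The tangent at some s < theta0, evaluated at 0, shows nu(0) > 0: the mean offspring number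
    exceeds 1. *)
Lemma laplace0_gt1 : 1 < fine (laplace P N X 0).
Proof.
have [s [/andP[s0 st] _ _ h]] := near_theta0 ltr01.
have p0 := pint_exp mN mX laplace0 theta0_mem (lexx 0) (ltW theta0_gt0).
rewrite -(expR_nu mN N_gt0 p0) -expR0 ltr_expR (lt_le_trans h)//.
have := nu_tangent mN N_gt0 (pint_exp mN mX laplace0 theta0_mem (ltW s0) (ltW st))
  (pint_id mN mX laplace0 theta0_mem s0 (ltW st)) p0.
by rewrite sub0r mulNr.
Qed.

End Theta0.

(** * Borel-Cantelli for geometrically small probabilities *)

Section BorelCantelli.
Context {R : realType} {d : measure_display} {Omega : measurableType d}.
Variable P : probability Omega R.

Lemma ae_eventually_not (F : nat -> set Omega) (c q : R) :
  (forall n, measurable (F n)) -> 0 <= c -> 0 <= q -> q < 1 ->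
  (forall n, P (F n) <= (c * q ^+ n)%:E)%E ->
  {ae P, forall w, \forall n \near \oo, ~ F n w}.
Proof.
move=> mF c0 q0 q1 PF; exists (lim_sup_set F); split.
- apply: bigcapT_measurable => n.
  by apply: bigcup_measurable => k _; exact: mF.
- apply: lim_sup_set_cvg0 => //.
  apply: (@le_lt_trans _ _ (\sum_(n <oo) (c * q ^+ n)%:E)%E).
    by apply: lee_nneseries => n *; [exact: measure_ge0|exact: PF].
  have cg : series (geometric c q) @ \oo --> c * (1 - q)^-1.
    by apply: cvg_geometric_series; rewrite ger0_norm.
  suff -> : (\sum_(n <oo) (c * q ^+ n)%:E = (c * (1 - q)^-1)%:E)%E by rewrite ltry.
  apply/cvg_lim => //; under eq_cvg do rewrite sumEFin.
  by apply/cvg_EFin; [exact: nearW|exact: cg].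
- move=> w /= nF n _; apply: contrapT => nw; apply: nF.
  exists n => // k /= nk Fk; apply: nw; by exists k.
Qed.

End BorelCantelli.

Lemma measurable_natr (R : realType) (A : set nat) :
  measurable ((fun n : nat => n%:R : R) @` A).
Proof.
apply: countable_measurable => //.
by apply: sub_countable; [exact: card_image_le|exact: countableP].
Qed.

(** * The marks of the tree and the law of one offspring *)

Section Model.
Context {R : realType} {d : measure_display} {Omega : measurableType d}.
Variables (P : probability Omega R) (N : seq nat -> Omega -> nat)
  (X : seq nat -> nat -> Omega -> R) (Y E : seq nat -> Omega -> R).
Hypothesis mN : forall u, measurable_fun setT (N u).
Hypothesis mX : forall u k, measurable_fun setT (X u k).
Hypothesis mY : forall u, measurable_fun setT (Y u).
Hypothesis mE : forall u, measurable_fun setT (E u).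

Definition index := ((seq nat + seq nat) + seq nat)%type.

(** Convertible to the family whose mutual independence the theorem assumes. *)
Definition marks (i : index) : set (set Omega) :=
  match i with
  | inl (inl u) => gen_sigma (pp_coords N X u)
  | inl (inr u) => gen_sigma (fun _ => Y u)
  | inr u => gen_sigma (fun _ => E u)
  end.

Definition vertex (i : index) : seq nat :=
  match i with inl (inl u) => u | inl (inr u) => u | inr u => u end.

Definition subtree (u : seq nat) : set index := [set i | prefix u (vertex i)].

Lemma measurable_pp_coords u k : measurable_fun setT (pp_coords N X u k).
Proof.
case: k => [|k] /=; last exact: mX.
by apply: (@measurableT_comp _ _ _ _ _ _ (fun n : nat => n%:R : R)).
Qed.

Lemma gen_sigma_measurable (Z : nat -> Omega -> R) :
  (forall k, measurable_fun setT (Z k)) -> gen_sigma Z `<=` measurable.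
Proof.
move=> mZ; apply: smallest_sub; first exact: sigma_algebra_measurable.
move=> _ [k [B [mB ->]]]; rewrite -[X in measurable X]setTI; exact: mZ.
Qed.

Lemma marks_measurable i : marks i `<=` measurable.
Proof.
case: i => [[u|u]|u]; apply: gen_sigma_measurable => k //.
exact: measurable_pp_coords.
Qed.

Lemma gen_sigmaT (Z : nat -> Omega -> R) : gen_sigma Z setT.
Proof.
have [_ h _] := smallest_sigma_algebra setT
  [set A | exists k (B : set R), measurable B /\ A = Z k @^-1` B].
rewrite -[X in gen_sigma Z X](setD0 setT); apply: h.
by have [] := smallest_sigma_algebra setT
  [set A | exists k (B : set R), measurable B /\ A = Z k @^-1` B].
Qed.

Lemma gen_sigmaI (Z : nat -> Omega -> R) : setI_closed (gen_sigma Z).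
Proof.
move=> A B GA GB.
exact: (@measurableI _ (g_sigma_algebraType
  [set A | exists k (B : set R), measurable B /\ A = Z k @^-1` B]) A B GA GB).
Qed.

Lemma marksT i : marks i setT.
Proof. by case: i => [[u|u]|u]; exact: gen_sigmaT. Qed.

Lemma marksI i : setI_closed (marks i).
Proof. by case: i => [[u|u]|u]; exact: gen_sigmaI. Qed.

Lemma gen_sigma_preimage (Z : nat -> Omega -> R) k B : measurable B ->
  gen_sigma Z (Z k @^-1` B).
Proof. by move=> mB; apply: sub_gen_smallest; exists k, B. Qed.

Local Notation F := (sigma_of marks).
Local Notation adapted := (adapted marks).

Lemma adapted_X (W : set index) u k : W (inl (inl u)) -> adapted W (X u k).
Proof.
move=> Wu; apply/adaptedP => B mB; apply: (sigma_of_gen Wu).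
exact: (gen_sigma_preimage (Z := pp_coords N X u) k.+1 mB).
Qed.

Lemma adapted_Y (W : set index) u : W (inl (inr u)) -> adapted W (Y u).
Proof.
move=> Wu; apply/adaptedP => B mB; apply: (sigma_of_gen Wu).
exact: (gen_sigma_preimage (Z := fun=> Y u) 0 mB).
Qed.

Lemma adapted_E (W : set index) u : W (inr u) -> adapted W (E u).
Proof.
move=> Wu; apply/adaptedP => B mB; apply: (sigma_of_gen Wu).
exact: (gen_sigma_preimage (Z := fun=> E u) 0 mB).
Qed.

Definition sigmaType (W : set index) :=
  g_sigma_algebraType [set A | exists2 i, W i & marks i A].

Lemma adapted_N (W : set index) u : W (inl (inl u)) ->
  measurable_fun [set: sigmaType W] (N u : sigmaType W -> nat).
Proof.
move=> Wu _ B _; rewrite setTI; apply: (sigma_of_gen Wu).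
have -> : N u @^-1` B = pp_coords N X u 0 @^-1` ((fun n : nat => n%:R : R) @` B).
  apply/seteqP; split => [w Bw|w /= [n Bn /eqP]]; first by exists (N u w).
  by rewrite eqr_nat => /eqP <-.
apply: gen_sigma_preimage.
exact: measurable_natr.
Qed.

Hypothesis laws : forall u, same_law P (pp_coords N X u) (pp_coords N X [::]).

Lemma same_law_cell u k (A : set nat) (B : set R) : measurable B ->
  P [set w | A (N u w) /\ B (X u k w)] = P [set w | A (N [::] w) /\ B (X [::] k w)].
Proof.
move=> mB.
pose C j : set R := if j == 0%N then (fun n : nat => n%:R : R) @` A
  else if j == k.+1 then B else setT.
have mC j : measurable (C j).
  rewrite /C; case: ifP => _; last by case: ifP.
  exact: measurable_natr.
(* Coordinate 0 carries [N] and coordinate [k.+1] carries child [k], whence [k.+2] coordinates; [C]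
   leaves those in between free. *)
have := @laws u k.+2 C mC.
have E' v : [set w | forall j, (j < k.+2)%N -> C j (pp_coords N X v j w)] =
    [set w | A (N v w) /\ B (X v k w)].
  apply/seteqP; split => [w Cw|w [Aw Bw] j jk].
    split; last by have := Cw k.+1 (ltnSn _); rewrite /C/= eqxx.
    have := Cw 0%N isT; rewrite /C/= => -[n An /eqP].
    by rewrite eqr_nat => /eqP <-.
  rewrite /C; case: eqP => [->|_] /=; first by exists (N v w).
  by case: eqP => [->|].
by rewrite !E'.
Qed.

Lemma measurable_N u (A : set nat) : measurable [set w | A (N u w)].
Proof. by rewrite -[X in measurable X]setTI; apply: mN. Qed.

Lemma measurable_offspring u k (phi : R -> R) : measurable_fun setT phi ->
  measurable_fun setT (fun w => (k < N u w)%N%:R * phi (X u k w)).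
Proof.
move=> mphi; apply: measurable_funM; first exact: measurable_nat_lt.
exact: measurableT_comp.
Qed.

Lemma integral_offspring u k (phi : R -> R) : measurable_fun setT phi ->
  (forall y, 0 <= phi y) ->
  (\int[P]_w ((k < N u w)%N%:R * phi (X u k w))%:E =
   \int[P]_w ((k < N [::] w)%N%:R * phi (X [::] k w))%:E)%E.
Proof.
move=> mphi phi0.
pose V v : {mfun Omega >-> R} := HB.pack (fun w => (k < N v w)%N%:R * phi (X v k w))
  (isMeasurableFun.Build _ _ _ _ _ (measurable_offspring v k mphi)).
have D v : (\int[P]_w ((k < N v w)%N%:R * phi (X v k w))%:E =
    \int[distribution P (V v)]_y `|y|%:E)%E.
  rewrite ge0_integral_distribution//; last first.
    by apply/measurable_EFinP; exact: normr_measurable.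
  by apply: eq_integral => w _ /=; rewrite ger0_norm// mulr_ge0.
rewrite !D; apply: eq_measure_integral => B mB _ /=.
rewrite /distribution /pushforward.
(* When child [k] is absent the statistic is 0, so that case contributes exactly when 0 lies in
   [B]. *)
have S v : P (V v @^-1` B) =
    (P [set w | (k < N v w)%N /\ (phi @^-1` B) (X v k w)] +
     P [set w | (N v w <= k)%N /\ (fun _ => B 0%R) (X v k w)])%E.
  have mlt : measurable [set w | (k < N v w)%N].
    exact: (measurable_N v [set n | (k < n)%N]).
  have mge : measurable [set w | (N v w <= k)%N].
    exact: (measurable_N v [set n | (n <= k)%N]).
  rewrite -measureU; last 3 first.
  - apply: measurableI => //; rewrite -[X in measurable X]setTI.
    apply: (measurableT_comp mphi (mX v k)) => //.
  - by have [B0|B0] := pselect (B 0%R); [rewrite (_ : [set _ | _] = [set w | (N v w <= k)%N]) //;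
      apply/seteqP; split=> w //= []|rewrite (_ : [set _ | _] = set0) //;
      apply/seteqP; split=> w //= []].
  - by apply/seteqP; split => w //= [[h1 _] [h2 _]]; rewrite leqNgt h1 in h2.
  congr (P _); apply/seteqP; split => w /=.
    by case: ltnP => h; rewrite ?mul1r ?mul0r; [left|right].
  by move=> [[h1 h2]|[h1 h2]]; rewrite ?h1 ?mul1r// ltnNge h1 mul0r.
rewrite !S; congr (_ + _)%E; last first.
  apply: (@same_law_cell u k [set n | (n <= k)%N] (fun=> B 0%R)).
  have [B0|B0] := pselect (B 0%R).
    by rewrite (_ : (fun=> _) = setT)//; apply/seteqP; split.
  by rewrite (_ : (fun=> _) = set0)//; apply/seteqP; split.
apply: (@same_law_cell u k [set n | (k < n)%N] (phi @^-1` B)).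
by rewrite -[X in measurable X]setTI; exact: (mphi measurableT B mB).
Qed.

End Model.

(** * Additive functionals and paths below a vertex *)

Section AdditiveFunctional.
Context {R : realType} {d : measure_display} {Omega : measurableType d}.
Variables (P : probability Omega R) (N : seq nat -> Omega -> nat)
  (X : seq nat -> nat -> Omega -> R) (Y E : seq nat -> Omega -> R).
Hypothesis mN : forall u, measurable_fun setT (N u).
Hypothesis mX : forall u k, measurable_fun setT (X u k).
Hypothesis mY : forall u, measurable_fun setT (Y u).
Hypothesis mE : forall u, measurable_fun setT (E u).
Hypothesis laws : forall u, same_law P (pp_coords N X u) (pp_coords N X [::]).
Hypothesis Gind : mutually_independent P (marks N X Y E).

Local Notation G := (marks N X Y E).
Local Notation F := (sigma_of G).
Let Gm := marks_measurable mN mX mY mE.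
Implicit Types (W : set index) (f g : Omega -> R) (u v : seq nat).

Lemma indep_marks W1 W2 : W1 `&` W2 = set0 -> indep_events P (F W1) (F W2).
Proof. by apply: sigma_of_indep => //; [exact: marksT|exact: marksI]. Qed.

Lemma adapted_mfun W f : adapted G W f -> measurable_fun setT f.
Proof. exact: adapted_measurable. Qed.

Lemma integralM_marks W1 W2 f g : W1 `&` W2 = set0 ->
  adapted G W1 f -> adapted G W2 g -> (forall w, 0 <= f w) -> (forall w, 0 <= g w) ->
  (\int[P]_w (f w * g w)%:E = \int[P]_w (f w)%:E * \int[P]_w (g w)%:E)%E.
Proof.
move=> W12 af ag f0 g0; apply: indep_integralM => //.
- exact: adapted_mfun af.
- exact: adapted_mfun ag.
- move=> A B mA mB; apply: (indep_marks W12).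
    by have /adaptedP := af; apply.
  by have /adaptedP := ag; apply.
Qed.

Lemma subtree_rcons u k : subtree (rcons u k) `<=` subtree u.
Proof.
by move=> i /prefixP[v iv]; apply/prefixP; exists (k :: v); rewrite iv cat_rcons.
Qed.

Lemma not_subtree_rcons u k i : vertex i = u -> ~ subtree (rcons u k) i.
Proof.
move=> iu /prefixP[v iv]; have := congr1 size iv; rewrite iu.
by rewrite size_cat size_rcons; lia.
Qed.

Lemma subtree_root u i : vertex i = u -> subtree u i.
Proof. by move=> iu; apply/prefixP; exists [::]; rewrite cats0 iu. Qed.

Lemma subtree_siblings u k l : k != l ->
  subtree (rcons u k) `&` subtree (rcons u l) = set0.
Proof.
move=> kl; apply/seteqP; split => // i [/prefixP[v iv] /prefixP[v' iv']].
have := iv'; rewrite iv => /(congr1 (fun z => nth 0%N z (size u))).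
rewrite !nth_cat !size_rcons !ltnS leqnn !nth_rcons !ltnn eqxx => klE.
by move/eqP: kl.
Qed.

Variables (s : R) (V : seq nat -> Omega -> R).
Hypothesis V0 : forall u w, 0 <= V u w.
Hypothesis aV : forall u, adapted G (subtree u) (V u).

(** The unnormalised additive martingale of the subtree at [u], with weights [V] at depth [n]. The
    recursion on the first generation is the branching property. *)
Fixpoint additive n u w : R :=
  if n is n'.+1
  then \sum_(k < N u w) expR (s * X u k w) * additive n' (rcons u k) w
  else V u w.

Lemma additive_ge0 n u w : 0 <= additive n u w.
Proof.
elim: n u => [|n IH] u /=; first exact: V0.
by apply: sumr_ge0 => k _; rewrite mulr_ge0 ?expR_ge0.
Qed.

Lemma adapted_expX (W : set index) u k : W (inl (inl u)) ->
  adapted G W (fun w => expR (s * X u k w)).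
Proof.
move=> Wu; have := @adapted_X _ _ _ N X Y E W u k Wu.
rewrite /adapted => aX; apply: measurableT_comp => //.
by apply: measurable_funM.
Qed.

Lemma adapted_additive n u : adapted G (subtree u) (additive n u).
Proof.
elim: n u => [|n IH] u /=; first exact: aV.
have Wu : subtree u (inl (inl u)) by exact: subtree_root.
apply: (@measurable_random_sum _ _ (sigmaType N X Y E (subtree u)) (N u)
   (fun k w => expR (s * X u k w) * additive n (rcons u k) w)).
  exact: adapted_N.
move=> k; apply: measurable_funM; first exact: adapted_expX.
by apply: adaptedS (IH (rcons u k)); exact: subtree_rcons.
Qed.

(** The marks at [u] are independent of the subtree of each child, so every generation contributes
    one factor [a]. The sum over the random number of children is handled as a series of
    expectations over the fixed labels k. *)
Lemma integral_additive (a c : R) n u : laplace P N X s = a%:E ->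
  (forall u, (\int[P]_w (V u w)%:E <= c%:E)%E) ->
  (\int[P]_w (additive n u w)%:E <= (a ^+ n * c)%:E)%E.
Proof.
move=> La Vc; elim: n u => [|n IH] u /=; first by rewrite expr0 mul1r.
have a0 : 0 <= a.
  rewrite -lee_fin -La; apply: integral_ge0 => w _.
  by rewrite lee_fin sumr_ge0// => i _; exact: expR_ge0.
have B0 : (0%:E <= \int[P]_w (V u w)%:E)%E.
  by apply: integral_ge0 => w _; rewrite lee_fin.
have c0 : 0 <= c by rewrite -lee_fin; exact: le_trans B0 (Vc u).
rewrite (@integral_random_sum _ _ _ P (N u)
  (fun k w => expR (s * X u k w) * additive n (rcons u k) w))//; last 2 first.
- move=> k; apply: measurable_funM.
    by apply: adapted_mfun; exact: (@adapted_expX setT).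
  by apply: adapted_mfun; exact: adapted_additive.
- by move=> k w; rewrite mulr_ge0 ?expR_ge0 ?additive_ge0.
pose m k := (\int[P]_w ((k < N [::] w)%N%:R * expR (s * X [::] k w))%:E)%E.
have m0 k : (0 <= m k)%E.
  by apply: integral_ge0 => w _; rewrite lee_fin mulr_ge0 ?expR_ge0.
have mU k : (\int[P]_w ((k < N u w)%N%:R * (expR (s * X u k w) * additive n (rcons u k) w))%:E
    <= (a ^+ n * c)%:E * m k)%E.
  under eq_integral do rewrite mulrA.
  rewrite (@integralM_marks [set i | i = inl (inl u)] (subtree (rcons u k))).
  - rewrite /m -(integral_offspring mN mX laws u k (phi := fun y => expR (s * y))).
    + by rewrite muleC lee_wpmul2r// integral_ge0// => w _; rewrite lee_fin mulr_ge0 ?expR_ge0.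
    + exact: measurable_expRM.
    + by move=> y; exact: expR_ge0.
  - by apply/seteqP; split => // i [-> /not_subtree_rcons]; exact.
  - apply: measurable_funM; last exact: adapted_expX.
    apply: (@measurable_nat_lt _ _ (sigmaType N X Y E [set i | i = inl (inl u)])).
    exact: adapted_N.
  - exact: adapted_additive.
  - by move=> w; rewrite mulr_ge0 ?expR_ge0.
  - by move=> w; exact: additive_ge0.
apply: (@le_trans _ _ (\sum_(k <oo) (a ^+ n * c)%:E * m k)%E).
  apply: lee_nneseries => k *; last exact: mU.
  apply: integral_ge0 => w _; rewrite lee_fin mulr_ge0// mulr_ge0 ?expR_ge0//.
  exact: additive_ge0.
rewrite nneseriesZl// /m -integral_random_sum//; last first.
  by move=> k; apply: measurableT_comp => //; exact: measurable_funM.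
by rewrite -/(laplace P N X s) La -EFinM lee_fin exprSr mulrAC.
Qed.

(** [in_tree] as seen from a vertex [u]; for the empty word it computes to [in_tree], as
    [displacement] does to [position]. *)
Definition descends (w : Omega) (u v : seq nat) :=
  forall j, (j < size v)%N -> (nth 0%N v j < N (u ++ take j v) w)%N.

Definition displacement (w : Omega) (u v : seq nat) : R :=
  \sum_(j < size v) X (u ++ take j v) (nth 0%N v j) w.

End AdditiveFunctional.

Section Descends.
Context {R : realType} {d : measure_display} {Omega : measurableType d}.
Variables (N : seq nat -> Omega -> nat) (X : seq nat -> nat -> Omega -> R).

Lemma descends_cons w u k v :
  descends N w u (k :: v) <-> (k < N u w)%N /\ descends N w (rcons u k) v.
Proof.
split=> [h|[h1 h2] [|j] /= jv]; last 2 first.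
- by rewrite cats0.
- by have := h2 j jv; rewrite cat_rcons.
split; first by have := h 0%N isT; rewrite /= cats0.
by move=> j jv; have := h j.+1 jv; rewrite /= cat_rcons.
Qed.

Lemma displacement_cons w u k v :
  displacement X w u (k :: v) = X u k w + displacement X w (rcons u k) v.
Proof.
rewrite /displacement big_ord_recl/= cats0; congr (_ + _).
by apply: eq_bigr => j _; rewrite /= cat_rcons.
Qed.

Lemma descends_cat w u v v' : descends N w u v -> descends N w (u ++ v) v' ->
  descends N w u (v ++ v').
Proof.
elim: v u => [|k v IH] u; first by rewrite cats0.
move=> /descends_cons[h1 h2]; rewrite -cat_rcons => h3; apply/descends_cons.
by split => //; exact: IH.
Qed.

Lemma displacement_cat w u v v' :
  displacement X w u (v ++ v') = displacement X w u v + displacement X w (u ++ v) v'.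
Proof.
elim: v u => [|k v IH] u.
  by rewrite cats0 /displacement big_ord0 add0r.
by rewrite /= !displacement_cons IH cat_rcons addrA.
Qed.

Lemma le_additive s (V : seq nat -> Omega -> R) w u v : (forall u w, 0 <= V u w) ->
  descends N w u v ->
  expR (s * displacement X w u v) * V (u ++ v) w <= additive N X s V (size v) u w.
Proof.
move=> V0; elim: v u => [|k v IH] u /=.
  by rewrite /displacement big_ord0 mulr0 expR0 mul1r cats0.
move=> /descends_cons[kN /IH {}IH].
rewrite (bigD1 (Ordinal kN))//= displacement_cons mulrDr expRD -mulrA.
rewrite -cat_rcons ler_wpDr ?ler_wpM2l ?expR_ge0//.
by apply: sumr_ge0 => i _; rewrite mulr_ge0 ?expR_ge0// additive_ge0.
Qed.

End Descends.

(** * Almost sure growth of additive functionals, and the negative moments of the exponential law *)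

Section UpperBound.
Context {R : realType} {d : measure_display} {Omega : measurableType d}.
Variables (P : probability Omega R) (N : seq nat -> Omega -> nat)
  (X : seq nat -> nat -> Omega -> R) (Y E : seq nat -> Omega -> R).
Hypothesis mN : forall u, measurable_fun setT (N u).
Hypothesis mX : forall u k, measurable_fun setT (X u k).
Hypothesis mY : forall u, measurable_fun setT (Y u).
Hypothesis mE : forall u, measurable_fun setT (E u).
Hypothesis laws : forall u, same_law P (pp_coords N X u) (pp_coords N X [::]).
Hypothesis Gind : mutually_independent P (marks N X Y E).

Local Notation G := (marks N X Y E).

Lemma ae_all_countable (T : countType) (Q : T -> Omega -> Prop) :
  (forall t, {ae P, forall w, Q t w}) -> {ae P, forall w, forall t, Q t w}.
Proof.
move=> h.
have : {ae P, forall w, forall n, if unpickle n is Some t then Q t w else True}.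
  apply: ae_foralln => n; case: (unpickle n) => [t|]; first exact: h.
  exact: aeW.
by apply: filterS => w hw t; have := hw (pickle t); rewrite pickleK.
Qed.

(** Markov's inequality at level exp(x n) gives probabilities of order (a / exp(x))^n, which are
    summable. *)
Lemma additive_eventually s (V : seq nat -> Omega -> R) a c x :
  (forall u w, 0 <= V u w) -> (forall u, adapted G (subtree u) (V u)) ->
  laplace P N X s = a%:E -> (forall u, (\int[P]_w (V u w)%:E <= c%:E)%E) ->
  a < expR x ->
  {ae P, forall w, \forall n \near \oo, additive N X s V n [::] w < expR (x *+ n)}.
Proof.
move=> V0 aV La Vc ax.
have a0 : 0 <= a.
  rewrite -lee_fin -La; apply: integral_ge0 => w _.
  by rewrite lee_fin sumr_ge0// => i _; exact: expR_ge0.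
have c0 : 0 <= c.
  by rewrite -lee_fin (le_trans _ (Vc [::]))// integral_ge0// => w _; rewrite lee_fin.
have mU n : measurable_fun setT (additive N X s V n [::]).
  by apply: (adapted_mfun mN mX mY mE); exact: adapted_additive.
pose B n := [set w | expR (x *+ n) <= additive N X s V n [::] w].
have mB n : measurable (B n).
  rewrite -[X in measurable X]setTI.
  have -> : B n = additive N X s V n [::] @^-1` `[expR (x *+ n), +oo[%classic.
    by apply/seteqP; split => w /=; rewrite in_itv/= andbT.
  by apply: mU.
have PB n : (P (B n) <= (c * (a / expR x) ^+ n)%:E)%E.
  have e0 := expR_gt0 (x *+ n).
  have /measurable_EFinP mU' := mU n.
  have := le_integral_abse P measurableT mU' e0.
  rewrite setTI (_ : [set _ | _] = B n); last first.
    apply/seteqP; split => w; rewrite /B/= lee_fin ger0_norm//; exact: additive_ge0.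
  move=> /le_trans /(_ (_ : _ <= (a ^+ n * c)%:E)%E) h.
  have : ((expR (x *+ n))%:E * P (B n) <= (a ^+ n * c)%:E)%E.
    apply: h; apply: le_trans (integral_additive mN mX mY mE laws Gind V0 aV n [::] La Vc).
    rewrite le_eqVlt; apply/orP; left; apply/eqP/eq_integral => w _.
    by rewrite gee0_abs// lee_fin; exact: additive_ge0.
  rewrite -lee_pdivlMl// => /le_trans; apply.
  by rewrite -EFinM lee_fin exprMn exprVn -expRM_natl mulr_natl; lra.
have := ae_eventually_not mB c0 _ _ PB.
rewrite divr_ge0 ?expR_ge0// ltr_pdivrMr ?expR_gt0// mul1r => /(_ isT ax).
by apply: filterS => w; apply: filterS => n /negP; rewrite -ltNge.
Qed.

Section ExponentialMoment.
Hypothesis lawE : forall u B, measurable B -> P (E u @^-1` B) = exponential_prob 1 B.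

Lemma exponential_small u (x : R) : 0 < x -> (P (E u @^-1` `[0%R, x]%classic) <= x%:E)%E.
Proof.
move=> x0; rewrite lawE// exponential_prob_itv0c// -EFinB lee_fin mulN1r.
by have := expR_ge1Dx (- x); lra.
Qed.

Lemma exponential_gt0 u : {ae P, forall w, 0 < E u w}.
Proof.
have mneg : measurable [set w | E u w <= 0].
  rewrite -[X in measurable X]setTI.
  have -> : [set w | E u w <= 0] = E u @^-1` `]-oo, 0]%classic.
    by apply/seteqP; split => w /=; rewrite in_itv.
  by apply: mE.
exists [set w | E u w <= 0]; split => //; last first.
  by move=> w /= /negP; rewrite -leNgt.
apply/eqP; rewrite eq_le measure_ge0 andbT.
have -> : [set w | E u w <= 0] = E u @^-1` `]-oo, 0]%classic.
  by apply/seteqP; split => w /=; rewrite in_itv.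
rewrite lawE// /exponential_prob.
rewrite -integral_itv_bndo_bndc; last first.
  by apply/measurable_funTS/measurable_EFinP; exact: measurable_exponential_pdf.
rewrite integral0_eq// => x /=; rewrite in_itv/= => x0.
by rewrite lt0_exponential_pdf.
Qed.

(** Split according to the integer part k of -ln E. On that layer the integrand is at most exp(r
    (k+1)), and the layer has probability at most exp(-k), so the series is geometric with ratio
    exp(r - 1) < 1. *)
Lemma exponential_moment r : 0 < r -> r < 1 ->
  exists c, forall u, (\int[P]_w (expR (- r * ln (E u w)))%:E <= c%:E)%E.
Proof.
move=> r0 r1.
pose q := expR (r - 1).
have q1 : q < 1 by rewrite /q -[ltRHS]expR0 ltr_expR; lra.
exists (1 + expR r * (1 - q)^-1) => u.
pose B k := E u @^-1` `[0%R, expR (- k%:R)]%classic.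
have mB k : measurable (B k) by rewrite -[X in measurable X]setTI; apply: mE.
have pw w : ((expR (- r * ln (E u w)))%:E <=
    1 + \sum_(k <oo) (expR (r * k.+1%:R) * \1_(B k) w)%:E)%E.
  have sum0 k : (0 <= (expR (r * k.+1%:R) * \1_(B k) w)%:E)%E.
    by rewrite lee_fin mulr_ge0 ?expR_ge0.
  (* [ln] is 0 on nonpositive reals, so the integrand is 1 there; the leading summand 1 covers this
     case as well as E >= 1. *)
  have [Ew|Ew] := leP (E u w) 0.
    by rewrite ln0// mulr0 expR0 leeDl// nneseries_ge0.
  pose t := - ln (E u w).
  have [t0|t0] := leP t 0.
    rewrite (@le_trans _ _ 1%E)// ?leeDl ?nneseries_ge0// lee_fin -expR0 ler_expR.
    by rewrite /t in t0; nra.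
  pose k := Num.truncn t.
  have /andP[k1 k2] : k%:R <= t < k.+1%:R by rewrite truncn_itv// ltW.
  have Bk : B k w.
    rewrite /B/= in_itv/= ltW//= -[leLHS]lnK ?posrE// ler_expR.
    by rewrite lerNr.
  rewrite (@nneseries_split _ _ 0 k.+1)//=.
  rewrite -[leLHS]add0e; apply: leeD => //.
  rewrite -[leLHS]adde0; apply: leeD; last by apply: nneseries_ge0.
  rewrite add0n big_nat_recr//= -[leLHS]add0e leeD// ?sume_ge0//.
  rewrite lee_fin indicE mem_set// mulr1 ler_expR.
  have -> : - r * ln (E u w) = r * t by rewrite /t; ring.
  by rewrite ler_wpM2l// ltW.
have mk k : measurable_fun setT (fun w => (expR (r * k.+1%:R) * \1_(B k) w)%:E).
  by apply/measurable_EFinP; apply: measurable_funM => //; exact: measurable_indic.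
have sum_ge0 w : (0 <= \sum_(k <oo) (expR (r * k.+1%:R) * \1_(B k) w)%:E)%E.
  by rewrite nneseries_ge0// => k *; rewrite lee_fin mulr_ge0 ?expR_ge0.
have msum : measurable_fun setT
    (fun w => (\sum_(k <oo) (expR (r * k.+1%:R) * \1_(B k) w)%:E)%E).
  by apply: ge0_emeasurable_sum => // k w *; rewrite lee_fin mulr_ge0 ?expR_ge0.
apply: (@le_trans _ _ (\int[P]_w
    (1 + \sum_(k <oo) (expR (r * k.+1%:R) * \1_(B k) w)%:E))%E).
  apply: ge0_le_integral => //.
  - apply/measurable_EFinP; apply: measurableT_comp => //; apply: measurable_funM => //.
    by apply: measurableT_comp => //; exact: measurable_ln.
  - exact: emeasurable_funD.
rewrite ge0_integralD//.
have -> : (\int[P]_w 1 = 1)%E by rewrite integral_cst// mul1e; exact: probability_setT.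
rewrite EFinD leeD2l//.
rewrite integral_nneseries//.
have cg : series (geometric (expR r) q) @ \oo --> expR r * (1 - q)^-1.
  by apply: cvg_geometric_series; rewrite ger0_norm ?expR_ge0.
have <- : (\sum_(k <oo) (expR r * q ^+ k)%:E = (expR r * (1 - q)^-1)%:E)%E.
  apply/cvg_lim => //; under eq_cvg do rewrite sumEFin.
  by apply/cvg_EFin; [exact: nearW|exact: cg].
apply: lee_nneseries => k *.
  by apply: integral_ge0 => w _; rewrite lee_fin mulr_ge0 ?expR_ge0.
under eq_integral do rewrite EFinM.
rewrite ge0_integralZl//; last first.
- by apply/measurable_EFinP; exact: measurable_indic.
rewrite integral_indic// setIT.
apply: (@le_trans _ _ ((expR (r * k.+1%:R))%:E * (expR (- k%:R))%:E)%E).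
  by rewrite lee_wpmul2l ?lee_fin ?expR_ge0// exponential_small// expR_gt0.
rewrite -EFinM lee_fin -expRD /q -expRM_natl -expRD ler_expR -natr1.
by rewrite le_eqVlt; apply/orP; left; apply/eqP; ring.
Qed.

End ExponentialMoment.

End UpperBound.

(** * Upper bound for the perturbed positions, and the line of first children *)

Section Perturbation.
Context {R : realType} {d : measure_display} {Omega : measurableType d}.
Variables (P : probability Omega R) (N : seq nat -> Omega -> nat)
  (X : seq nat -> nat -> Omega -> R) (Y E : seq nat -> Omega -> R)
  (mu : probability R R) (theta : R).
Hypothesis mN : forall u, measurable_fun setT (N u).
Hypothesis mX : forall u k, measurable_fun setT (X u k).
Hypothesis mY : forall u, measurable_fun setT (Y u).
Hypothesis mE : forall u, measurable_fun setT (E u).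
Hypothesis laws : forall u, same_law P (pp_coords N X u) (pp_coords N X [::]).
Hypothesis Gind : mutually_independent P (marks N X Y E).
Hypothesis lawY : forall u B, measurable B -> P (Y u @^-1` B) = mu B.
Hypothesis lawE : forall u B, measurable B -> P (E u @^-1` B) = exponential_prob 1 B.
Hypothesis mu_pos : mu [set y | y <= 0] = 0%E.
Hypothesis N_gt0 : P [set w | N [::] w = 0%N] = 0%E.
Hypothesis theta_gt0 : 0 < theta.

Local Notation G := (marks N X Y E).

Lemma ae_offspring : {ae P, forall w, forall u, (0 < N u w)%N}.
Proof.
apply: ae_all_countable => u; exists [set w | N u w = 0%N]; split.
- exact: (measurable_N mN u [set 0%N]).
- rewrite -N_gt0; have := same_law_cell laws u 0 [set 0%N] (B := setT) measurableT.
  have E' v : [set w | [set 0%N] (N v w) /\ [set: R] (X v 0%N w)] = [set w | N v w = 0%N].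
    by apply/seteqP; split => w //= [].
  by rewrite !E'.
- by move=> w /= /negP; rewrite -leqNgt leqn0 => /eqP.
Qed.

Lemma ae_Y_gt0 : {ae P, forall w, forall u, 0 < Y u w}.
Proof.
have mneg : measurable [set y : R | y <= 0].
  by rewrite -[X in measurable X]/(`]-oo, 0%R]%classic).
apply: ae_all_countable => u; exists (Y u @^-1` [set y | y <= 0]); split.
- by rewrite -[X in measurable X]setTI; apply: mY.
- by rewrite lawY.
- by move=> w /= /negP; rewrite -leNgt.
Qed.

Lemma ae_E_gt0 : {ae P, forall w, forall u, 0 < E u w}.
Proof. by apply: ae_all_countable => u; exact: exponential_gt0. Qed.

Lemma measurable_expln (r : R) : measurable_fun [set: R] (fun y => expR (r * ln y)).
Proof.
by apply: measurableT_comp => //; apply: measurable_funM => //; exact: measurable_ln.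
Qed.

Lemma Y_moment r : (\int[mu]_y (`|y| `^ r)%:E < +oo)%E ->
  exists c, forall u, (\int[P]_w (expR (r * ln (Y u w)))%:E <= c%:E)%E.
Proof.
move=> moo.
have mpow : measurable_fun [set: R] (fun y : R => `|y| `^ r).
  apply: (@measurableT_comp _ _ _ _ _ _ (@powR R ^~ r) _ (@Num.norm R R)); first exact: measurable_powR.
  exact: normr_measurable.
(* The added 1 dominates [expR (r * ln y)] at nonpositive [y], where [ln] takes its default value
   0. *)
have : (\int[mu]_y (`|y| `^ r + 1)%:E < +oo)%E.
  under eq_integral do rewrite EFinD.
  rewrite ge0_integralD//; last first.
    exact/measurable_EFinP.
  rewrite lte_add_pinfty// integral_cst// mul1e.
  by rewrite (le_lt_trans (probability_le1 _ _)) ?ltry.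
set I := (\int[mu]_y (`|y| `^ r + 1)%:E)%E => Ioo.
have I0 : (0 <= I)%E.
  by apply: integral_ge0 => y _; rewrite lee_fin addr_ge0 ?powR_ge0.
exists (fine I) => u; rewrite fineK ?ge0_fin_numE//.
pose V : {mfun Omega >-> R} := HB.pack (Y u) (isMeasurableFun.Build _ _ _ _ _ (mY u)).
have -> : (\int[P]_w (expR (r * ln (Y u w)))%:E =
    \int[distribution P V]_y (expR (r * ln y))%:E)%E.
  rewrite ge0_integral_distribution//.
  by apply/measurable_EFinP; exact: measurable_expln.
have -> : (\int[distribution P V]_y (expR (r * ln y))%:E =
    \int[mu]_y (expR (r * ln y))%:E)%E.
  by apply: eq_measure_integral => B mB _; exact: lawY.
apply: ge0_le_integral => //.
- by apply/measurable_EFinP; exact: measurable_expln.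
- by apply/measurable_EFinP; exact: measurable_funD.
- move=> y _; rewrite lee_fin; have [y0|y0] := leP y 0.
    by rewrite ln0// mulr0 expR0 lerDr powR_ge0.
  by rewrite gtr0_norm// /powR gt_eqF// lerDl.
Qed.

(** The power (Y/E)^r, split into factors that depend on disjoint marks. *)
Definition pert_moment r u w := expR (r * ln (Y u w)) * expR (- r * ln (E u w)).

Lemma pert_moment_ge0 r u w : 0 <= pert_moment r u w.
Proof. by rewrite mulr_ge0 ?expR_ge0. Qed.

Lemma adapted_expln W f (r : R) : adapted G W f ->
  adapted G W (fun w => expR (r * ln (f w))).
Proof. by move=> af; exact: (measurableT_comp (measurable_expln r) af). Qed.

Lemma adapted_pert_moment r u : adapted G (subtree u) (pert_moment r u).
Proof.
apply: measurable_funM; apply: adapted_expln.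
  by apply: adapted_Y; exact: subtree_root.
by apply: adapted_E; exact: subtree_root.
Qed.

Lemma integral_pert_moment r : 0 < r -> r < 1 ->
  (\int[mu]_y (`|y| `^ r)%:E < +oo)%E ->
  exists c, forall u, (\int[P]_w (pert_moment r u w)%:E <= c%:E)%E.
Proof.
move=> r0 r1 /Y_moment[c1 h1]; have [c2 h2] := exponential_moment mE lawE r0 r1.
exists (c1 * c2) => u.
rewrite (@integralM_marks _ _ _ P N X Y E mN mX mY mE Gind
  [set i | i = inl (inr u)] [set i | i = inr u]).
- rewrite EFinM lee_pmul// integral_ge0// => w _; rewrite lee_fin expR_ge0//.
- by apply/seteqP; split => // i [/= ->].
- by apply: adapted_expln; exact: adapted_Y.
- by apply: adapted_expln; exact: adapted_E.
- by move=> w; exact: expR_ge0.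
- by move=> w; exact: expR_ge0.
Qed.

(** With weights (Y/E)^(s/theta), exp(s S*_v) is a single term of the additive functional, so a
    bound on the sum bounds every vertex of the generation. *)
Lemma pert_upper s a x : 0 < s -> s / theta < 1 ->
  (\int[mu]_y (`|y| `^ (s / theta))%:E < +oo)%E ->
  laplace P N X s = a%:E -> a < expR (s * x) ->
  {ae P, forall w, \forall n \near \oo, forall v, in_tree N w v -> size v = n ->
     pert_position theta X Y E w v <= x * n%:R}.
Proof.
move=> s0 st1 mom La ax.
have r0 : 0 < s / theta by rewrite divr_gt0.
have [c hc] := integral_pert_moment r0 st1 mom.
have HU := additive_eventually mN mX mY mE laws Gind
  (pert_moment_ge0 (s / theta)) (adapted_pert_moment (s / theta)) La hc ax.
apply: filterS3 HU ae_E_gt0 ae_Y_gt0 => w Uw E0 Y0.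
apply: filterS Uw => n Un v vT vn.
have dv : descends N w [::] v by [].
have := le_additive X s (pert_moment_ge0 (s / theta)) dv; rewrite vn => /le_lt_trans /(_ Un).
rewrite /pert_moment -expRD -expRD ltr_expR => h; rewrite -mulr_natr in h.
rewrite /pert_position lnM ?posrE ?invr_gt0// lnV ?posrE//.
rewrite -(ler_pM2l s0) ltW// [ltRHS]mulrA; apply: le_lt_trans h => /=.
rewrite le_eqVlt; apply/orP; left; apply/eqP; rewrite /displacement /position /=.
by field; rewrite gt_eqF.
Qed.

(** A Chernoff bound at a negative exponent, with weights 1. The all-zero word is in the tree
    because every vertex almost surely has a first child. *)
Lemma path_lower t a C : 0 < t -> laplace P N X (- t) = a%:E -> a < expR (t * C) ->
  {ae P, forall w, \forall n \near \oo,
     - (C * n%:R) <= displacement X w [::] (nseq n 0%N)}.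
Proof.
move=> t0 La aC.
have Vc (u : seq nat) : (\int[P]_w (1 : R)%:E <= (1 : R)%:E)%E.
  by rewrite integral_cst// mul1e; exact: probability_le1.
have HU := additive_eventually mN mX mY mE laws Gind (V := fun _ _ => 1)
  (fun _ _ => ler01) (fun _ => measurable_cst _) La Vc aC.
apply: filterS2 HU ae_offspring => w Uw N0; apply: filterS Uw => n Un.
have dn : descends N w [::] (nseq n 0%N).
  by move=> j; rewrite size_nseq => jn; rewrite nth_nseq jn.
have := le_additive X (- t) (V := fun _ _ => 1) (fun _ _ => ler01) dn.
rewrite size_nseq mulr1 => /le_lt_trans /(_ Un).
rewrite ltr_expR => h; rewrite -mulr_natr mulNr -mulrA -mulrN ltr_pM2l// ltrNl in h.
exact: ltW.
Qed.

End Perturbation.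

(** * Success events in the truncated tree and their recursive lower bound *)

Section GoodEvents.
Context {R : realType} {d : measure_display} {Omega : measurableType d}.
Variables (P : probability Omega R) (N : seq nat -> Omega -> nat)
  (X : seq nat -> nat -> Omega -> R) (Y E : seq nat -> Omega -> R).
Hypothesis mN : forall u, measurable_fun setT (N u).
Hypothesis mX : forall u k, measurable_fun setT (X u k).
Hypothesis mY : forall u, measurable_fun setT (Y u).
Hypothesis mE : forall u, measurable_fun setT (E u).
Hypothesis laws : forall u, same_law P (pp_coords N X u) (pp_coords N X [::]).
Hypothesis Gind : mutually_independent P (marks N X Y E).

Local Notation G := (marks N X Y E).
Local Notation F := (sigma_of G).
Implicit Types (W : set index) (f : Omega -> R).

Lemma adaptedM W f f' : adapted G W f -> adapted G W f' -> adapted G W (f \* f').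
Proof. by move=> af af'; exact: measurable_funM. Qed.

Lemma adapted_sum (J : Type) (r : seq J) W (f : J -> Omega -> R) :
  (forall j, adapted G W (f j)) -> adapted G W (fun w => \sum_(j <- r) f j w).
Proof. by move=> af; apply: measurable_sum. Qed.

Lemma adapted_prod (J : eqType) (r : seq J) W (f : J -> Omega -> R) :
  (forall j, adapted G W (f j)) -> adapted G W (fun w => \prod_(j <- r) f j w).
Proof. by move=> af; apply: measurable_prod => j _; exact: af. Qed.

(** Conditioning on [W1] in inequality form: the factors [g] are independent of everything else and
    may be traded for bounds on their means. *)
Lemma integral_replace (J : finType) W1 W2 f (c g : J -> Omega -> R) (b : J -> R) :
  W1 `&` W2 = set0 -> adapted G W1 f -> (forall w, 0 <= f w) ->
  (forall j, adapted G W1 (c j)) -> (forall j w, 0 <= c j w) ->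
  (forall j, adapted G W2 (g j)) -> (forall j w, 0 <= g j w) ->
  (forall j, (\int[P]_w (g j w)%:E <= (b j)%:E)%E) ->
  (\int[P]_w (f w * \sum_j c j w * g j w)%:E <=
   \int[P]_w (f w * \sum_j c j w * b j)%:E)%E.
Proof.
move=> W12 af f0 ac c0 ag g0 gb.
have b0 j : 0 <= b j.
  by rewrite -lee_fin (le_trans _ (gb j))// integral_ge0// => w _; rewrite lee_fin.
have mfc j : measurable_fun setT (fun w => f w * c j w).
  exact: measurable_funM (adapted_mfun mN mX mY mE af) (adapted_mfun mN mX mY mE (ac j)).
have mg j : measurable_fun setT (g j) by exact: (adapted_mfun mN mX mY mE (ag j)).
have expand (h : J -> Omega -> R) : (forall j, measurable_fun setT (h j)) ->
    (forall j w, 0 <= h j w) ->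
    (\int[P]_w (f w * \sum_j c j w * h j w)%:E =
     \sum_j \int[P]_w (f w * c j w * h j w)%:E)%E.
  move=> mh h0; rewrite -ge0_integral_sum//.
  - by apply: eq_integral => w _; rewrite sumEFin mulr_sumr; congr (_%:E);
      apply: eq_bigr => j _; rewrite mulrA.
  - by move=> j; apply/measurable_EFinP; exact: measurable_funM.
  - by move=> j w _; rewrite lee_fin !mulr_ge0.
rewrite (expand g)// (expand (fun j _ => b j))//.
apply: lee_sum => j _.
rewrite (@integralM_marks _ _ _ P N X Y E mN mX mY mE Gind W1 W2)//; last 2 first.
- exact: adaptedM.
- by move=> w; rewrite mulr_ge0.
under [leRHS]eq_integral do rewrite EFinM.
rewrite ge0_integralZr//; last 3 first.
- exact/measurable_EFinP.
- by move=> w _; rewrite lee_fin mulr_ge0.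
- by rewrite lee_fin.
by rewrite lee_wpmul2l// integral_ge0// => w _; rewrite lee_fin mulr_ge0.
Qed.

Variables (M L : nat) (C : nat -> set R) (v : nat -> R) (y0 e0 : R).
Hypothesis mC : forall i, measurable (C i).
Hypothesis tC : trivIset setT C.

(** [hits] and [good] describe the reduced tree: only the first [M] children count, and a jump into
    cell [C i] is recorded as [v i]. Unfolded, [good n u y] asks for a path of length [n] with
    recorded rise at least [y] whose endpoint has Y/E at least y0/e0. *)
Definition hits u k i : set Omega := [set w | (k < N u w)%N /\ C i (X u k w)].

Fixpoint good n u y : set Omega :=
  if n is n'.+1 then
    [set w | exists (k : 'I_M) (i : 'I_L),
       hits u k i w /\ good n' (rcons u k) (y - v i)%R w]
  else [set w | [/\ y <= 0, y0 <= Y u w & 0 < E u w <= e0]].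

Lemma good_descends n u y w : (forall i x, C i x -> v i <= x) -> good n u y w ->
  exists t, [/\ size t = n, descends N w u t, y <= displacement X w u t,
    y0 <= Y (u ++ t) w & 0 < E (u ++ t) w <= e0].
Proof.
move=> vC; elim: n u y => [|n IH] u y /=.
  move=> [yle hY hE]; exists [::]; split => //; rewrite ?cats0//.
  by rewrite /displacement big_ord0.
move=> [k [i [[kN Ci] /IH[t [tn dt yt hY hE]]]]]; exists (nat_of_ord k :: t).
rewrite -cat_rcons; split => //=; first by rewrite tn.
- exact/descends_cons.
- by rewrite displacement_cons; have := vC _ _ Ci; lra.
Qed.

Lemma hits_sigma W u k i : W (inl (inl u)) -> F W (hits u k i).
Proof.
move=> Wu.
have h1 : F W [set w | (k < N u w)%N].
  have := @adapted_N _ _ _ N X Y E W u Wu measurableT [set m | (k < m)%N] I.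
  by rewrite setTI.
have h2 : F W (X u k @^-1` C i).
  by have /adaptedP := @adapted_X _ _ _ N X Y E W u k Wu; apply; exact: mC.
exact: (@measurableI _ (sigmaType N X Y E W) _ _ h1 h2).
Qed.

Lemma good_sigma n u y : F (subtree u) (good n u y).
Proof.
elim: n u y => [|n IH] u y /=.
  have [y_le0|y_gt0] := leP y 0; last first.
    rewrite (_ : [set w | _] = set0); last by apply/seteqP; split => w //= [].
    exact: (@measurable0 _ (sigmaType N X Y E (subtree u))).
  have hY : F (subtree u) (Y u @^-1` `[y0, +oo[%classic).
    have /adaptedP := @adapted_Y _ _ _ N X Y E (subtree u) u (subtree_root erefl).
    by apply.
  have hE : F (subtree u) (E u @^-1` `]0%R, e0]%classic).
    have /adaptedP := @adapted_E _ _ _ N X Y E (subtree u) u (subtree_root erefl).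
    by apply.
  rewrite (_ : [set w | _] = Y u @^-1` `[y0, +oo[%classic `&` E u @^-1` `]0%R, e0]%classic).
    exact: (@measurableI _ (sigmaType N X Y E (subtree u)) _ _ hY hE).
  apply/seteqP; split => w /=; rewrite !in_itv/= andbT; first by case.
  by move=> [].
rewrite (_ : [set w | _] = \bigcup_(k in [set: 'I_M]) \bigcup_(i in [set: 'I_L])
   (hits u k i `&` good n (rcons u k) (y - v i)%R)); last first.
  apply/seteqP; split => w /= [k].
    by move=> [i h]; exists k => //; exists i.
  by move=> _ [i _ h]; exists k, i.
apply: (@fin_bigcup_measurable _ (sigmaType N X Y E (subtree u))) => // k _.
apply: (@fin_bigcup_measurable _ (sigmaType N X Y E (subtree u))) => // i _.
apply: (@measurableI _ (sigmaType N X Y E (subtree u))).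
  by apply: hits_sigma; exact: subtree_root.
by apply: (sigma_ofS (@subtree_rcons u k)); exact: IH.
Qed.

Lemma good_measurable n u y : measurable (good n u y).
Proof.
apply: (sigma_of_measurable (marks_measurable mN mX mY mE)); exact: good_sigma.
Qed.

Lemma hits_measurable u k i : measurable (hits u k i).
Proof.
by apply: (sigma_of_measurable (marks_measurable mN mX mY mE) (W := setT)); exact: hits_sigma.
Qed.

Lemma sum_hits_le1 u k w : \sum_(i < L) \1_(hits u k i) w <= 1 :> R.
Proof.
have [[i hi]|nh] := pselect (exists i : 'I_L, hits u k i w); last first.
  rewrite big1// => i _; rewrite indicE memNset// => hi; apply: nh; by exists i.
rewrite (bigD1 i)//= big1 ?addr0 ?indicE ?lern1 ?leq_b1// => j ji.
rewrite indicE memNset// => hj.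
have /trivIsetP := tC; move=> /(_ j i I I).
move=> /(_ ji) /seteqP[+ _] => /(_ (X u k w)); apply.
by split; [case: hj|case: hi].
Qed.

Lemma prob_hits u k i : P (hits u k i) = P (hits [::] k i).
Proof. exact: (same_law_cell laws u k [set n | (k < n)%N]). Qed.

Lemma sum_option (J : finType) (r : option J -> R) :
  \sum_j r j = r None + \sum_i r (Some i).
Proof.
rewrite (bigD1 None)//=; congr (_ + _).
rewrite (reindex_omap Some id)//=; last by case.
by apply: eq_bigl => j; rewrite eqxx.
Qed.

Section Step.
Variables (n : nat) (u : seq nat) (y eta : R) (b : nat -> R).
Hypothesis b01 : forall i, 0 <= b i <= eta.
Hypothesis eta1 : eta <= 1.
Hypothesis Meta : M%:R * eta <= 1.
Hypothesis b_good : forall (k : 'I_M) (i : 'I_L),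
  ((b i)%:E <= P (good n (rcons u k) (y - v i)%R))%E.

(* [None] stands for the vertex falling in none of the cells. *)
Let c k (j : option 'I_L) w : R :=
  if j is Some i then \1_(hits u k i) w else 1 - \sum_(i < L) \1_(hits u k i) w.
Let g (k : nat) (j : option 'I_L) w : R :=
  if j is Some i then 1 - \1_(good n (rcons u k) (y - v i)%R) w else 1.
Let beta (j : option 'I_L) : R := if j is Some i then 1 - b i else 1.
(** The indicator that child [k] does not lead to success; [l] below is the same sum with the
    subtree events replaced by the probability bounds. *)
Let h k w := \sum_j c k j w * g k j w.
Let l k w := \sum_j c k j w * beta j.
Let away (ks : seq nat) : set index :=
  [set i | forall k, k \in ks -> ~ subtree (rcons u k) i].

Let c_ge0 k j w : 0 <= c k j w.
Proof. by case: j => [i|] //=; rewrite subr_ge0 sum_hits_le1. Qed.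

Let g_ge0 k j w : 0 <= g k j w.
Proof. by case: j => [i|] //=; rewrite indicE subr_ge0 lern1 leq_b1. Qed.

Let beta_ge0 j : 0 <= beta j.
Proof.
case: j => [i|] //=; rewrite subr_ge0.
by have /andP[_ /le_trans] := b01 i; apply.
Qed.

Let adapted_c ks k j : adapted G (away ks) (c k j).
Proof.
have Wu : away ks (inl (inl u)) by move=> k' _; exact: not_subtree_rcons.
have hi i : adapted G (away ks) (\1_(hits u k i)).
  by apply: adapted_indic; exact: hits_sigma.
case: j => [i|] /=; first exact: hi.
by apply: measurable_funB; [exact: measurable_cst|apply: adapted_sum => i; exact: hi].
Qed.

Let adapted_g W k j : subtree (rcons u k) `<=` W -> adapted G W (g k j).
Proof.
move=> uW; case: j => [i|] /=; last exact: measurable_cst.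
apply: measurable_funB; first exact: measurable_cst.
by apply: adapted_indic; apply: (sigma_ofS uW); exact: good_sigma.
Qed.

Let adapted_l ks k : adapted G (away ks) (l k).
Proof.
by apply: adapted_sum => j; apply: measurable_funM; [exact: adapted_c|exact: measurable_cst].
Qed.

Let h_ge0 k w : 0 <= h k w.
Proof. by apply: sumr_ge0 => j _; rewrite mulr_ge0. Qed.

Let l_ge0 k w : 0 <= l k w.
Proof. by apply: sumr_ge0 => j _; rewrite mulr_ge0. Qed.

Let integral_g (k : 'I_M) j : (\int[P]_w (g k j w)%:E <= (beta j)%:E)%E.
Proof.
case: j => [i|] /=; last first.
  by rewrite integral_cst// mul1e; exact: probability_le1.
have mg := good_measurable n (rcons u k) (y - v i)%R.
have -> : (\int[P]_w (1 - \1_(good n (rcons u k) (y - v i)%R) w)%:E =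
    P (~` good n (rcons u k) (y - v i)%R))%E.
  transitivity (\int[P]_w (\1_(~` good n (rcons u k) (y - v i)%R) w)%:E)%E; last first.
    by rewrite integral_indic ?setIT//; exact: measurableC.
  apply: eq_integral => w _; congr (_%:E); rewrite !indicE in_setC.
  by case: (w \in _); rewrite /= ?subrr ?subr0.
by rewrite probability_setC// EFinB leeB// b_good.
Qed.

(* The children are independent given the root mark: conditionally on the
   cells, the events of the subtrees are replaced one at a time. *)
Let replace_children ks f : uniq ks -> {subset ks <= gtn M} ->
  adapted G (away ks) f -> (forall w, 0 <= f w) ->
  (\int[P]_w (f w * \prod_(k <- ks) h k w)%:E <=
   \int[P]_w (f w * \prod_(k <- ks) l k w)%:E)%E.
Proof.
elim: ks f => [|k ks IH] f.
  by move=> *; rewrite le_eqVlt; apply/orP; left; apply/eqP/eq_integral => w _; rewrite !big_nil.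
move=> /= /andP[kks uks] ksM af f0.
have kM : (k < M)%N by apply: ksM; rewrite mem_head.
have sub : away (k :: ks) `<=` away ks.
  by move=> i ai k' k'ks; apply: ai; rewrite inE k'ks orbT.
have kaway : subtree (rcons u k) `<=` away ks.
  move=> i ki k' k'ks k'i.
  have kk' : k != k' by apply: contraNneq kks => ->.
  by have : set0 i by rewrite -(subtree_siblings u kk').
(* First [h k] is absorbed into [f] while the other children are replaced. Afterwards all other
   factors are independent of the subtree of [k], and [h k] can be replaced in turn. *)
apply: (@le_trans _ _ (\int[P]_w ((f w * h k w) * \prod_(k <- ks) l k w)%:E)%E).
  under eq_integral do rewrite big_cons mulrA.
  apply: IH => //.
  - by move=> k' k'ks; apply: ksM; rewrite inE k'ks orbT.
  - apply: adaptedM; first exact: adaptedS af.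
    by apply: adapted_sum => j; apply: adaptedM; [exact: adapted_c|exact: adapted_g].
  - by move=> w; rewrite mulr_ge0.
under eq_integral do rewrite mulrAC.
under [leRHS]eq_integral do rewrite big_cons (mulrC (l k _)) mulrA.
apply: (@integral_replace _ (away (k :: ks)) (subtree (rcons u k))) => //.
- by apply/seteqP; split => // i [+ ki] => /(_ k (mem_head _ _)); exact.
- by apply: adaptedM => //; apply: adapted_prod => k'; exact: adapted_l.
- by move=> w; rewrite mulr_ge0// prodr_ge0.
- by move=> j; exact: adapted_g.
- by move=> j; exact: (integral_g (Ordinal kM)).
Qed.

(** Failure means that each of the [M] children fails. After replacement its probability is at most
    the mean of a product of factors 1 - om, which [prod_one_minus] linearises at the cost of the
    factor 1 - M eta. *)
Lemma good_step : (((1 - M%:R * eta) *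
    \sum_(k < M) \sum_(i < L) fine (P (hits [::] k i)) * b i)%:E <=
  P (good n.+1 u y))%E.
Proof.
have mgood := good_measurable n.+1 u y.
have mhit k i := hits_measurable u k i.
pose om k w : R := \sum_(i < L) \1_(hits u k i) w * b i.
have lE k w : l k w = 1 - om k w.
  rewrite /l /om sum_option/= mulr1 -addrA; congr (_ + _).
  by rewrite -!sumrN -big_split/=; apply: eq_bigr => i _; rewrite mulrBr mulr1; lra.
have hE k w : h k w = 1 - \sum_(i < L) \1_(hits u k i) w * \1_(good n (rcons u k) (y - v i)%R) w.
  rewrite /h sum_option/= mulr1 -addrA; congr (_ + _).
  by rewrite -!sumrN -big_split/=; apply: eq_bigr => i _; rewrite mulrBr mulr1; lra.
have om01 k w : 0 <= om k w <= eta.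
  apply/andP; split.
    by apply: sumr_ge0 => i _; rewrite mulr_ge0//; have /andP[] := b01 i.
  have eta0 : 0 <= eta by have /andP[] := b01 0; exact: le_trans.
  apply: (@le_trans _ _ (\sum_(i < L) \1_(hits u k i) w * eta)).
    by apply: ler_sum => i _; rewrite ler_wpM2l//; have /andP[] := b01 i.
  by rewrite -mulr_suml ler_piMl// sum_hits_le1.
pose kappa := 1 - M%:R * eta.
have kappa0 : 0 <= kappa by rewrite subr_ge0.
have bad_le : (P (~` good n.+1 u y) <= \int[P]_w (\prod_(k <- iota 0 M) l k w)%:E)%E.
  apply: (@le_trans _ _ (\int[P]_w (1 * \prod_(k <- iota 0 M) h k w)%:E)%E).
    have <- : (\int[P]_w (\1_(~` good n.+1 u y) w)%:E = P (~` good n.+1 u y))%E.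
      by rewrite integral_indic ?setIT//; exact: measurableC.
    apply: ge0_le_integral => //.
    - by apply/measurable_EFinP; apply: measurable_indic; exact: measurableC.
    - apply/measurable_EFinP; apply: measurable_funM => //.
      apply: measurable_prod => k _; apply: measurable_sum => j.
      have mc : measurable_fun setT (c k j).
        exact: (adapted_mfun mN mX mY mE (@adapted_c [::] k j)).
      have mg : measurable_fun setT (g k j).
        exact: (adapted_mfun mN mX mY mE (@adapted_g setT k j (@subsetT _ _))).
      exact: measurable_funM.
    - move=> w _; rewrite lee_fin mul1r indicE.
      have [gw|ngw] := pselect (good n.+1 u y w).
        by rewrite memNset//= prodr_ge0.
      rewrite mem_set//= big_seq big1// => k; rewrite mem_iota/= add0n => kM.
      rewrite hE big1 ?subr0// => i _.
      have [hi|nhi] := pselect (hits u k i w); last by rewrite indicE memNset// mul0r.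
      have [gi|ngi] := pselect (good n (rcons u k) (y - v i)%R w).
        by exfalso; apply: ngw; exists (Ordinal kM), i.
      by rewrite [X in _ * X]indicE memNset// mulr0.
  rewrite (le_trans (replace_children (iota_uniq 0 M) _ _ _))//.
  - by move=> k; rewrite mem_iota/= add0n inE.
  - exact: measurable_cst.
  - by under eq_integral do rewrite mul1r.
have ml k : measurable_fun setT (l k).
  by exact: (adapted_mfun mN mX mY mE (@adapted_l [::] k)).
have momi k i : measurable_fun setT (fun w => (\1_(hits u k i) w * b i)%:E).
  by apply/measurable_EFinP; apply: measurable_funM => //; exact: measurable_indic.
(* The linearised inequality, integrated; as a sum it involves only nonnegative integrands. *)
have le1 : (\int[P]_w ((\prod_(k <- iota 0 M) l k w)%:E +
    (kappa * \sum_(k <- iota 0 M) om k w)%:E) <= 1)%E.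
  apply: (@le_trans _ _ (\int[P]_w 1)%E); last first.
    by rewrite integral_cst// mul1e; exact: probability_le1.
  apply: ge0_le_integral => //.
  - move=> w _; rewrite adde_ge0// lee_fin ?prodr_ge0// mulr_ge0// sumr_ge0// => k _.
    by have /andP[] := om01 k w.
  - apply: emeasurable_funD; apply/measurable_EFinP.
      exact: measurable_prod.
    apply: measurable_funM => //; apply: measurable_sum => k.
    by apply: measurable_sum => i; apply/measurable_EFinP; exact: momi.
  - move=> w _; rewrite -EFinD lee_fin.
    have := @prod_one_minus R nat (iota 0 M) (om ^~ w) eta (om01 ^~ w).
    rewrite size_iota => /(_ Meta)/andP[_].
    by under eq_bigr do rewrite -lE; rewrite /kappa; lra.
move: le1; rewrite ge0_integralD//; last 4 first.
- by move=> w _; rewrite lee_fin prodr_ge0.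
- by apply/measurable_EFinP; exact: measurable_prod.
- move=> w _; rewrite lee_fin mulr_ge0// sumr_ge0// => k _.
  by have /andP[] := om01 k w.
- apply/measurable_EFinP; apply: measurable_funM => //; apply: measurable_sum => k.
  by apply: measurable_sum => i; apply/measurable_EFinP; exact: momi.
have -> : (\int[P]_w (kappa * \sum_(k <- iota 0 M) om k w)%:E =
   (kappa * \sum_(k < M) \sum_(i < L) fine (P (hits [::] k i)) * b i)%:E)%E.
  under eq_integral do rewrite EFinM.
  rewrite ge0_integralZl//; last 2 first.
  - apply/measurable_EFinP; apply: measurable_sum => k.
    by apply: measurable_sum => i; apply/measurable_EFinP; exact: momi.
  - by move=> w _; rewrite lee_fin sumr_ge0// => k _; have /andP[] := om01 k w.
  rewrite EFinM; congr (_ * _)%E.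
  rewrite -(big_mkord xpredT (fun k => \sum_(i < L) fine (P (hits [::] k i)) * b i)).
  rewrite /index_iota subn0.
  under eq_integral do rewrite -sumEFin.
  rewrite ge0_integral_sum//; last 2 first.
  - move=> k; apply/measurable_EFinP.
    by apply: measurable_sum => i; apply/measurable_EFinP; exact: momi.
  - by move=> k w _; rewrite lee_fin; have /andP[] := om01 k w.
  rewrite -sumEFin; apply: eq_bigr => k _.
  under eq_integral do rewrite -sumEFin.
  rewrite ge0_integral_sum//; last first.
    by move=> i w _; rewrite lee_fin mulr_ge0//; have /andP[] := b01 i.
  rewrite -sumEFin; apply: eq_bigr => i _.
  under eq_integral do rewrite EFinM.
  rewrite ge0_integralZr//; last 2 first.
  - by apply/measurable_EFinP; exact: measurable_indic.
  - by rewrite lee_fin; have /andP[] := b01 i.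
  by rewrite integral_indic// setIT EFinM fineK; [congr (_ * _)%E; exact: prob_hits|exact/fin_num_measure/hits_measurable].
move: bad_le; rewrite probability_setC// -/kappa.
set K := kappa * _ => h1 h2.
have h3 : ((1 - P (good n.+1 u y)) + K%:E <= 1)%E by apply: le_trans h2; exact: leeD.
move: h3; rewrite -(fineK (fin_num_measure P _ mgood)) -EFinB -EFinD !lee_fin; lra.
Qed.
End Step.

(** Induction on the depth with [good_step]: the hypothesis on [om] says precisely that the barrier,
    shifted by [a] in each generation, survives one step. *)
Lemma good_lower (om : R -> R) (a eta : R) :
  (forall z, 0 <= om z <= eta) -> eta <= 1 -> M%:R * eta <= 1 ->
  (forall z, om (z - a) <= (1 - M%:R * eta) *
     \sum_(k < M) \sum_(i < L) fine (P (hits [::] k i)) * om (z - v i)) ->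
  (forall u y, ((om y)%:E <= P (good 0 u y))%E) ->
  forall n u y, ((om (y - a * n%:R))%:E <= P (good n u y))%E.
Proof.
move=> om01 eta1 Meta super leaf; elim=> [|n IH] u y; first by rewrite mulr0 subr0.
have shift i : y - v i - a * n%:R = y - a * n%:R - v i by ring.
have := @good_step n u y eta (fun i => om (y - v i - a * n%:R)).
move=> /(_ (fun i => om01 _) eta1 Meta (fun k i => IH _ _)); apply: le_trans.
rewrite lee_fin (_ : y - a * n.+1%:R = y - a * n%:R - a); last first.
  by rewrite -natr1; ring.
apply: (le_trans (super _)); rewrite le_eqVlt; apply/orP; left; apply/eqP.
by congr (_ * _); apply: eq_bigr => k _; apply: eq_bigr => i _; rewrite shift.
Qed.


End GoodEvents.

(** * Discretising the displacements *)

Section Cells.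
Context {R : realType}.
Implicit Types (n i : nat) (y : R).

(* At level [n], with mesh [1 / n.+1], the cells [cell n i] with
   [i < ncells n] cover [[- n.+1, n.+1)]. *)
Definition cell n i : set R := [set y | i%:R <= (y + n.+1%:R) * n.+1%:R < i.+1%:R].
Definition cell_low n i : R := i%:R / n.+1%:R - n.+1%:R.
Definition ncells n : nat := (n.+1 + n.+1) * n.+1.

Lemma measurable_cell n i : measurable (cell n i).
Proof.
have mf : measurable_fun [set: R] (fun y => (y + n.+1%:R) * n.+1%:R).
  by apply: measurable_funM => //; exact: measurable_funD.
have -> : cell n i = (fun y => (y + n.+1%:R) * n.+1%:R) @^-1` `[i%:R, i.+1%:R[%classic.
  by apply/seteqP; split => y /=; rewrite in_itv.
by rewrite -[X in measurable X]setTI; apply: mf.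
Qed.

Lemma trivIset_cell n : trivIset setT (cell n).
Proof.
apply: ltn_trivIset => i j ij; apply/seteqP; split => // y [/andP[h1 h2] /andP[h3 h4]].
have : j.+1%:R <= i%:R :> R by rewrite ler_nat.
by move=> /le_trans /(_ h3) /(lt_le_trans h2); rewrite ltxx.
Qed.

Lemma cell_bounds n i y : cell n i y ->
  cell_low n i <= y < cell_low n i + n.+1%:R^-1.
Proof.
rewrite /cell /cell_low /= => /andP[h1 h2].
have M0 : 0 < n.+1%:R :> R by [].
apply/andP; split; first by rewrite lerBlDr ler_pdivrMr.
rewrite addrAC -{2}[n.+1%:R^-1]mul1r -mulrDl ltrBrDr ltr_pdivlMr//.
by rewrite natr1.
Qed.

Lemma cell_exists n y : `|y| < n.+1%:R -> exists2 i, (i < ncells n)%N & cell n i y.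
Proof.
move=> /ltr_normlP[y1 y2].
have M0 : 0 < n.+1%:R :> R by [].
have z0 : 0 <= (y + n.+1%:R) * n.+1%:R by rewrite mulr_ge0//; lra.
exists (Num.truncn ((y + n.+1%:R) * n.+1%:R)); last by rewrite /cell/= truncn_itv.
have /andP[t1 _] := truncn_itv z0; rewrite -(ltr_nat R) (le_lt_trans t1)//.
by rewrite /ncells natrM natrD ltr_pM2r//; lra.
Qed.

Definition step n (F : R -> R) y : R :=
  \sum_(i < ncells n) \1_(cell n i) y * F (cell_low n i).

Lemma step_cell n F i y : (i < ncells n)%N -> cell n i y ->
  step n F y = F (cell_low n i).
Proof.
move=> iL yi; rewrite /step (bigD1 (Ordinal iL))//= indicE mem_set// mul1r.
rewrite big1 ?addr0// => j ji; rewrite indicE memNset ?mul0r// => yj.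
have /trivIsetP/(_ j i I I) := @trivIset_cell n; rewrite -val_eqE/= in ji.
by move=> /(_ ji)/seteqP[+ _] => /(_ y); apply.
Qed.

Lemma step_abs_le n F dom y : (forall i, cell n i y -> `|F (cell_low n i)| <= dom y) ->
  0 <= dom y -> `|step n F y| <= dom y.
Proof.
move=> h dom0; have [[i [iL yi]]|no] := pselect (exists i, (i < ncells n)%N /\ cell n i y).
  by rewrite (step_cell F iL yi); exact: h.
rewrite /step big1 ?normr0// => i _; rewrite indicE memNset ?mul0r// => yi.
by apply: no; exists i.
Qed.

Lemma step_cvg F y : continuous F -> (fun n => step n F y) @ \oo --> F y.
Proof.
move=> cF; apply/cvgrPdist_lt => e e0.
have /cvgrPdist_lt /(_ _ e0) := cF y.
move=> /nbhs_ballP[del /= del0 hdel]; near=> n.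
have yn : `|y| < n.+1%:R.
  near: n; exists (Num.truncn `|y|) => // m /= ym.
  by rewrite (lt_le_trans (truncnS_gt _))// ler_nat ltnS.
have [i iL yi] := cell_exists yn; rewrite (step_cell F iL yi).
have /andP[h1 h2] := cell_bounds yi.
have idel : n.+1%:R^-1 < del by near: n; exact: near_infty_natSinv_lt (PosNum del0).
by apply: hdel; rewrite /ball/= ger0_norm ?subr_ge0// ltrBlDl (lt_trans h2)// ltrD2l.
Unshelve. all: by end_near. Qed.

End Cells.

Section Discretization.
Context {R : realType} {d : measure_display} {Omega : measurableType d}.
Variables (P : probability Omega R) (N : seq nat -> Omega -> nat)
  (X : seq nat -> nat -> Omega -> R).
Hypothesis mN : forall u, measurable_fun setT (N u).
Hypothesis mX : forall u k, measurable_fun setT (X u k).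
Local Notation weight n k i := (fine (P (hits N X (cell n) [::] k i))).

(** The double sum is the mean of a statistic that keeps [n.+1] children and replaces [F] by a step
    function, so truncation and mesh are refined together. Dominated convergence applies because
    [dom], taken at the true position, bounds [F] at the rounded one. *)
Lemma disc_cvg (F dom : R -> R) : continuous F -> measurable_fun setT F ->
  psum_integrable P N X dom -> (forall y, 0 <= dom y) ->
  (forall n i y, cell n i y -> `|F (cell_low n i)| <= dom y) ->
  (fun n => \sum_(k < n.+1) \sum_(i < ncells n) weight n k i * F (cell_low n i)) @ \oo
    --> \int[P]_w psum N X F w.
Proof.
move=> cF mF [mdom idom] dom0 Fdom.
have mhit n k i : measurable (hits N X (cell n) [::] k i).
  apply: measurableI; first exact: (measurable_N mN [::] [set m | (k < m)%N]).
  rewrite -[X in measurable X]setTI; apply: mX => //; exact: measurable_cell.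
have mstep n : measurable_fun setT (step n F).
  apply: measurable_sum => i; apply: measurable_funM => //.
  by apply: measurable_indic; exact: measurable_cell.
pose f n w := \sum_(k < n.+1) ((k < N [::] w)%N%:R * step n F (X [::] k w)).
have fE n w : f n w = \sum_(k < n.+1) \sum_(i < ncells n)
    \1_(hits N X (cell n) [::] k i) w * F (cell_low n i).
  apply: eq_bigr => k _; rewrite mulr_sumr; apply: eq_bigr => i _; rewrite mulrA.
  congr (_ * _); rewrite !indicE -natrM mulnb; congr (nat_of_bool _)%:R.
  apply/idP/idP; first by move=> /andP[h1]; rewrite !inE => h2; split.
  by rewrite !inE => -[-> ?]; rewrite mem_set.
have ifk n k i : P.-integrable setT
    (fun w => (\1_(hits N X (cell n) [::] k i) w * F (cell_low n i))%:E).
  under eq_fun do rewrite EFinM.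
  apply: integrableZr => //; exact: integrable_indic.
have intf n : \int[P]_w f n w =
    \sum_(k < n.+1) \sum_(i < ncells n) weight n k i * F (cell_low n i).
  rewrite /Rintegral; under eq_integral do rewrite fE -sumEFin.
  rewrite integral_sum//; last first.
    by move=> k; under eq_fun do rewrite -sumEFin; exact: integrable_sum.
  rewrite -[RHS]/(fine (_%:E)) -sumEFin; congr fine; apply: eq_bigr => k _.
  under eq_integral do rewrite -sumEFin.
  rewrite integral_sum// -sumEFin; apply: eq_bigr => i _.
  under eq_integral do rewrite EFinM.
  rewrite integralZr//; last exact: integrable_indic.
  by rewrite integral_indic// setIT EFinM fineK; [|exact/fin_num_measure/mhit].
under eq_cvg do rewrite -intf.
apply: (real_dominated_cvg (g := psum N X dom) _ _ _ idom _).2.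
- move=> n; apply: measurable_sum => k.
  by apply: measurable_offspring.
- exact: measurable_psum.
- move=> w; rewrite /psum.
  apply: (@cvg_trans _ ((fun n => \sum_(k < N [::] w) step n F (X [::] k w)) @ \oo)); last first.
    by apply: cvg_big => [|k _]; [exact: add_continuous|exact: step_cvg].
  apply: near_eq_cvg; exists (N [::] w) => // n /= /leqW Nn.
  rewrite (big_ord_widen _ (fun k => step n F (X [::] k w)) Nn) [LHS]big_mkcond/=.
  by apply: eq_bigr => k _; case: ifP => _; rewrite ?mul1r ?mul0r.
- move=> n w; rewrite /f /psum (le_trans (ler_norm_sum _ _ _))//.
  (* Both sums are padded with zeros to a common length before being compared term by term. *)
  have -> : \sum_(k < N [::] w) dom (X [::] k w) =
     \sum_(k < maxn n.+1 (N [::] w)) (k < N [::] w)%N%:R * dom (X [::] k w).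
    rewrite (big_ord_widen _ (fun k => dom (X [::] k w)) (leq_maxr n.+1 (N [::] w))).
    by rewrite [LHS]big_mkcond/=; apply: eq_bigr => k _; case: ifP => _; rewrite ?mul1r ?mul0r.
  rewrite (big_ord_widen _ (fun k => `|(k < N [::] w)%N%:R * step n F (X [::] k w)|) (leq_maxl n.+1 (N [::] w))).
  rewrite [leLHS]big_mkcond/=; apply: ler_sum => k _; case: ifP => _; last by rewrite mulr_ge0.
  by rewrite normrM ger0_norm// ler_wpM2l// step_abs_le// => i; exact: Fdom.
Qed.

(** Since s > 0 and positions are rounded down, exp(s y) dominates its own discretisation; for the
    derivative, rounding by at most 1 costs an extra exp(s y). *)
Lemma discretization s : 0 < s -> psum_integrable P N X (fun y => expR (s * y)) ->
  psum_integrable P N X (fun y => `|y| * expR (s * y)) ->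
  (fun n => \sum_(k < n.+1) \sum_(i < ncells n) weight n k i * expR (s * cell_low n i)) @ \oo
    --> fine (laplace P N X s) /\
  (fun n => \sum_(k < n.+1) \sum_(i < ncells n)
      weight n k i * (cell_low n i * expR (s * cell_low n i))) @ \oo --> dlaplace P N X s.
Proof.
move=> s0 ie ia.
have cexp : continuous (fun y : R => expR (s * y)).
  move=> y; apply: (@continuous_comp _ _ _ (fun y : R => s * y) expR); last exact: continuous_expR.
  exact: mulrl_continuous.
split.
  apply: (disc_cvg (F := fun y => expR (s * y)) (dom := fun y => expR (s * y))) => //.
  - exact: measurable_expRM.
  - move=> n i y /cell_bounds/andP[h _].
    by rewrite ger0_norm ?expR_ge0// ler_expR ler_pM2l.
apply: (disc_cvg (F := fun y => y * expR (s * y))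
  (dom := fun y => `|y| * expR (s * y) + expR (s * y))).
- by move=> y; apply: (cvgM (f := id)); [exact: cvg_id|exact: cexp].
- exact: measurable_idM.
- exact: psum_integrableD.
- by move=> y; rewrite addr_ge0 ?mulr_ge0 ?expR_ge0.
- move=> n i y /cell_bounds/andP[h1 h2].
  rewrite normrM (ger0_norm (expR_ge0 _)) -{2}[expR (s * y)]mul1r -mulrDl.
  have i1 : n.+1%:R^-1 <= 1 :> R by rewrite invf_le1// ler1n.
  rewrite ler_pM// ?expR_ge0// ?ler_expR ?ler_pM2l//.
  have := ler_norm y; have := ler_norm (- y); rewrite normrN ler_norml.
  move: (n.+1%:R^-1) (cell_low n i) h1 h2 i1 => q z h1 h2 i1 h3 h4.
  by apply/andP; split; lra.
Qed.

End Discretization.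

(** * The travelling barrier *)

(** The tilted weights are centred at [a], so the tilted bump loses only a factor 1 - t in one step.
    Mass above 1 pays for this loss and for the factor 1 - M eta. *)
Lemma supersolution (R : realType) (I : finType) (p v : I -> R) (s a eta0 : R) (M : nat) :
  (forall i, 0 <= p i) -> \sum_i p i * (v i * expR (s * v i)) = a * \sum_i p i * expR (s * v i) ->
  1 < \sum_i p i * expR (s * (v i - a)) -> 0 < eta0 -> eta0 <= 1 ->
  exists (om : R -> R) (eta K : R),
    [/\ forall z, 0 <= om z <= eta, eta <= eta0, M%:R * eta <= 1,
      forall z, om (z - a) <= (1 - M%:R * eta) * \sum_i p i * om (z - v i) &
      [/\ forall z, 0 < z -> om z = 0 & 0 < om (- K)]].
Proof.
move=> p0 drift mass h0 h1.
set Phi := \sum_i _ in mass.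
(* Then (1 - t) Phi = (Phi + 1) / 2, so (1 - t)^2 Phi = (Phi + 1)^2 / (4 Phi) >= 1: there is room
   for two losses of size [t]. *)
pose t := (Phi - 1) / (2 * Phi).
have Phi0 : 0 < Phi by lra.
have t0 : 0 < t by rewrite divr_gt0//; lra.
have tPhi : t * (2 * Phi) = Phi - 1 by rewrite /t mulfVK// mulf_neq0// gt_eqF.
have t1 : t < 1 by nra.
pose eta := t * eta0 / M.+1%:R.
have M0 : 0 < M.+1%:R :> R by [].
have Meta : eta * M.+1%:R = t * eta0 by rewrite /eta mulfVK// gt_eqF.
have eta_gt0 : 0 < eta by rewrite divr_gt0// mulr_gt0.
have Mle : M%:R * eta <= t.
  have : M.+1%:R * eta <= t by rewrite mulrC Meta ler_piMr// ltW.
  by rewrite -natr1 mulrDl; lra.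
have eta_le : eta <= eta0.
  have : eta <= eta * M.+1%:R by rewrite ler_peMr ?ler1n// ltW.
  by rewrite Meta; nra.
pose c i := v i - a.
pose C := 1 + \sum_i `|c i|.
have C1 : 1 <= C by rewrite /C lerDl sumr_ge0.
have cC i : `|c i| <= C.
  by rewrite /C (bigD1 i)//= addrCA lerDl addr_ge0// sumr_ge0.
(* The first two summands meet the two size conditions of [tilted_bump_super] with e = t; the last
   gives K >= 1, hence K <= K^2. *)
pose K := 4 * C + 8 * C ^+ 2 / t + 1.
have q0 : 0 <= 8 * C ^+ 2 / t by apply: divr_ge0; [apply: mulr_ge0 => //; exact: sqr_ge0|exact: ltW].
have K1 : 1 <= K by rewrite /K; lra.
have CK : 4 * C <= K by rewrite /K; lra.
have CeK : 8 * C ^+ 2 <= t * K ^+ 2.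
  have qK : 8 * C ^+ 2 / t <= K by rewrite /K; lra.
  have : 8 * C ^+ 2 <= t * K by rewrite (mulrC t) -ler_pdivrMr.
  have : t * K <= t * K ^+ 2 by rewrite ler_pM2l// expr2 ler_peMr//; lra.
  by lra.
have K0 : 0 < K by lra.
pose kap := 1 - M%:R * eta.
have kap0 : 0 <= kap by rewrite /kap; lra.
have K4 : 0 < K ^+ 4 * expR (`|s| * K) by apply: mulr_gt0; [exact: exprn_gt0|exact: expR_gt0].
pose nrm := eta / (K ^+ 4 * expR (`|s| * K)).
have nrm0 : 0 < nrm by rewrite divr_gt0.
pose B z := expR (- s * z) * bump K z.
have super z : B z <= \sum_i kap * p i * B (z - c i).
  apply: (@tilted_bump_super R I (fun i => kap * p i) c C K s t) => //.
  - by move=> i; rewrite mulr_ge0.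
  - by lra.
  - have -> : \sum_i kap * p i * expR (s * c i) * c i =
      kap * expR (- (s * a)) * (\sum_i p i * (v i * expR (s * v i)) -
        a * \sum_i p i * expR (s * v i)).
      rewrite mulr_sumr -sumrB mulr_sumr; apply: eq_bigr => i _.
      rewrite (_ : s * c i = s * v i + - (s * a)); last by rewrite /c; ring.
      by rewrite expRD /c; ring.
    by rewrite drift subrr mulr0.
  - have -> : \sum_i kap * p i * expR (s * c i) = kap * Phi.
      by rewrite /Phi mulr_sumr; apply: eq_bigr => i _; rewrite mulrA.
    have : (1 - t) * Phi <= kap * Phi by rewrite ler_pM2r// /kap; lra.
    by move=> h; have : (1 - t) * ((1 - t) * Phi) <= (1 - t) * (kap * Phi);
      [rewrite ler_wpM2l//; lra|nra].
have B0 z : 0 <= B z by rewrite mulr_ge0 ?expR_ge0 ?bump_ge0.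
have BK z : B z <= K ^+ 4 * expR (`|s| * K).
  have [zK|zK] := ltP `|z| K; last first.
    by rewrite /B /bump ltNge zK/= mulr0 ltW.
  rewrite /B [leRHS]mulrC; apply: ler_pM; [exact: expR_ge0|exact: bump_ge0| |];
    last by apply: bump_le; exact: ltW.
  rewrite ler_expR (le_trans (ler_norm _))// normrM normrN ler_wpM2l// ltW//.
(* [nrm] brings the supremum below [eta]. The shift by [K] moves the support to negative arguments,
   to match the condition y <= 0 at a leaf, and puts the centre of the bump at -K. *)
exists (fun z => nrm * B (z + K)), eta, K; split => //.
- move=> z; apply/andP; split; first by apply: mulr_ge0; [exact: ltW|exact: B0].
  rewrite /nrm mulrAC ler_pdivrMr//; apply: ler_wpM2l; [exact: ltW|exact: BK].
- by lra.
- move=> z; have := super (z - a + K); rewrite -(ler_pM2l nrm0) => /le_trans; apply.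
  rewrite -/kap !mulr_sumr le_eqVlt; apply/orP; left; apply/eqP; apply: eq_bigr => i _.
  by rewrite (_ : z - a + K - c i = z - v i + K) /c; ring.
- split=> [z z0|]; last first.
    rewrite mulr_gt0// addNr /B mulr0 expR0 mul1r /bump normr0 K0.
    by rewrite expr0n/= subr0 exprn_gt0// exprn_gt0.
  rewrite /B /bump ifF ?mulr0 ?mulr0//.
  by apply/negbTE; rewrite -leNgt ger0_norm; lra.
Qed.

(** * A perturbation bounded below with positive probability, and linear rise *)

Section Leaves.
Context {R : realType} {d : measure_display} {Omega : measurableType d}.
Variables (P : probability Omega R) (N : seq nat -> Omega -> nat)
  (X : seq nat -> nat -> Omega -> R) (Y E : seq nat -> Omega -> R)
  (mu : probability R R).
Hypothesis mN : forall u, measurable_fun setT (N u).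
Hypothesis mX : forall u k, measurable_fun setT (X u k).
Hypothesis mY : forall u, measurable_fun setT (Y u).
Hypothesis mE : forall u, measurable_fun setT (E u).
Hypothesis Gind : mutually_independent P (marks N X Y E).
Hypothesis lawY : forall u B, measurable B -> P (Y u @^-1` B) = mu B.
Hypothesis lawE : forall u B, measurable B -> P (E u @^-1` B) = exponential_prob 1 B.
Hypothesis mu_pos : mu [set y | y <= 0] = 0%E.

Lemma measure_bigcup_gt0 d' (T : measurableType d') (m : {measure set T -> \bar R})
    (A : nat -> set T) : (forall n, measurable (A n)) ->
  (0 < m (\bigcup_n A n))%E -> exists n, (0 < m (A n))%E.
Proof.
move=> mA A0; apply: contrapT => no.
have A00 n : m (A n) = 0%E.
  apply/eqP; rewrite eq_le measure_ge0 andbT leNgt; apply/negP => h.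
  by apply: no; exists n.
suff : m (\bigcup_n A n) = 0%E by move=> h; rewrite h ltxx in A0.
apply: measure_negligible; first by apply: bigcup_measurable => k _; exact: mA.
by apply: negligible_bigcup => n; exists (A n); split.
Qed.

(** As [mu] lives on the positive reals, some half-line starting at 1/(n+1) has positive mass; [Y]
    and [E] at a vertex are independent, so the two probabilities multiply. *)
Lemma leaf_prob : exists y0 p : R, [/\ 0 < y0, 0 < p, p <= 1 &
  forall u, (p%:E <= P [set w | (y0 <= Y u w)%R /\ (0 < E u w <= 1)%R])%E].
Proof.
have [n hn] : exists n : nat, (0 < mu `[(n.+1%:R^-1 : R)%R, +oo[%classic)%E.
  apply: measure_bigcup_gt0; first by move=> n; exact: measurable_itv.
  have -> : \bigcup_n `[(n.+1%:R^-1 : R)%R, +oo[%classic = ~` [set y : R | y <= 0].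
    apply/seteqP; split => y /=.
      move=> [n _] /=; rewrite in_itv/= andbT => ny; apply/negP.
      by rewrite -ltNge (lt_le_trans _ ny)// invr_gt0.
    move=> /negP; rewrite -ltNge => y0; exists (Num.truncn y^-1) => //=.
    rewrite in_itv/= andbT invf_ple ?posrE// ltW// truncnS_gt//.
  suff : (0 < mu (~` [set y : R | (y <= 0)%R]))%E by [].
  rewrite probability_setC; last by rewrite -[X in measurable X]/(`]-oo, 0%R]%classic).
  by rewrite [X in (_ - X)%E]mu_pos sube0.
pose y0 : R := n.+1%:R^-1.
have mI : measurable `[y0%R, +oo[%classic by exact: measurable_itv.
pose p1 := fine (mu `[y0%R, +oo[%classic).
have p1E : mu `[y0%R, +oo[%classic = p1%:E by rewrite fineK// fin_num_measure.
have p10 : 0 < p1 by rewrite -lte_fin -p1E.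
pose p2 : R := 1 - expR (-1).
have p2E u : P (E u @^-1` `]0%R, 1%R]%classic) = p2%:E.
  rewrite lawE// /exponential_prob integral_itv_obnd_cbnd.
    by have := @exponential_prob_itv0c R 1 1 ltr01; rewrite /exponential_prob mulr1 => ->.
  by apply/measurable_funTS/measurable_EFinP; exact: measurable_exponential_pdf.
have p20 : 0 < p2 by rewrite /p2 subr_gt0 -[ltRHS]expR0 ltr_expR; lra.
have joint u : P [set w | (y0 <= Y u w)%R /\ (0 < E u w <= 1)%R] = (p1 * p2)%:E.
  have -> : [set w | (y0 <= Y u w)%R /\ (0 < E u w <= 1)%R] =
      Y u @^-1` `[y0%R, +oo[%classic `&` E u @^-1` `]0%R, 1%R]%classic.
    by apply/seteqP; split => w /=; rewrite !in_itv/= andbT.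
  have := @indep_marks _ _ _ P N X Y E mN mX mY mE Gind [set i | i = inl (inr u)] [set i | i = inr u].
  move=> ->.
  - by rewrite lawY// p1E p2E.
  - by apply/seteqP; split => // i [/= ->].
  - have /adaptedP := @adapted_Y _ _ _ N X Y E [set i | i = inl (inr u)] u erefl.
    by apply.
  - have /adaptedP := @adapted_E _ _ _ N X Y E [set i | i = inr u] u erefl.
    by apply.
exists y0, (p1 * p2); split; rewrite ?mulr_gt0 ?invr_gt0//; last by move=> u; rewrite joint.
rewrite -lee_fin -(joint [::]) probability_le1//.
have -> : [set w | (y0 <= Y [::] w)%R /\ (0 < E [::] w <= 1)%R] =
    Y [::] @^-1` `[y0%R, +oo[%classic `&` E [::] @^-1` `]0%R, 1%R]%classic.
  by apply/seteqP; split => w /=; rewrite !in_itv/= andbT.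
by apply: measurableI; rewrite -[X in measurable X]setTI; [apply: mY|apply: mE].
Qed.

End Leaves.

Section GoodLinear.
Context {R : realType} {d : measure_display} {Omega : measurableType d}.
Variables (P : probability Omega R) (N : seq nat -> Omega -> nat)
  (X : seq nat -> nat -> Omega -> R) (Y E : seq nat -> Omega -> R)
  (mu : probability R R).
Hypothesis mN : forall u, measurable_fun setT (N u).
Hypothesis mX : forall u k, measurable_fun setT (X u k).
Hypothesis mY : forall u, measurable_fun setT (Y u).
Hypothesis mE : forall u, measurable_fun setT (E u).
Hypothesis laws : forall u, same_law P (pp_coords N X u) (pp_coords N X [::]).
Hypothesis Gind : mutually_independent P (marks N X Y E).
Hypothesis lawY : forall u B, measurable B -> P (Y u @^-1` B) = mu B.
Hypothesis lawE : forall u B, measurable B -> P (E u @^-1` B) = exponential_prob 1 B.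
Hypothesis mu_pos : mu [set y | y <= 0] = 0%E.
Hypothesis N_gt0 : P [set w | N [::] w = 0%N] = 0%E.

(* The drift [a] is chosen so that [s] minimises the truncated, discretised
   Laplace transform of the displacements relative to [a]; the minimum is
   above 1 because it is close to [expR (nu s - s * nu' s)]. *)
Lemma good_linear s e : 0 < s -> psum_integrable P N X (fun y => expR (s * y)) ->
  psum_integrable P N X (fun y => `|y| * expR (s * y)) ->
  0 < nu P N X s - s * nu' P N X s -> 0 < e ->
  exists (n : nat) (a y0 K p : R), [/\ nu' P N X s - e < a, 0 < y0, 0 < p &
    forall m u, (p%:E <= P (good N X Y E n.+1 (ncells n) (cell n) (cell_low n) y0%R 1%R
      m u (a * m%:R - K)%R))%E].
Proof.
move=> s0 ie ia int0 e0.
have [cS cT] := discretization mN mX s0 ie ia.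
set S := (fun n => _) in cS; set T := (fun n => _) in cT.
have A0 := laplace_gt0 (mN [::]) N_gt0 ie.
(* [T n / S n] is the mean displacement under the discretised tilted weights; taken as the drift
   [a], it makes the relative displacements centred. *)
have cA : (fun n => T n / S n) @ \oo --> nu' P N X s.
  rewrite (nu'E (mN [::]) N_gt0 ie); apply: cvgM => //.
  by apply: cvgV => //; rewrite gt_eqF.
have cPhi : (fun n => S n * expR (- s * (T n / S n))) @ \oo -->
    expR (nu P N X s - s * nu' P N X s).
  rewrite expRD (expR_nu (mN [::]) N_gt0 ie) -mulNr; apply: cvgM => //.
  apply: (cvg_comp _ expR); last exact: continuous_expR.
  by apply: cvgM => //; exact: cvg_cst.
have H1 := cvgr_gt _ cA (nu' P N X s - e) ltac:(by rewrite ltrBlDr ltrDl).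
have H2 := cvgr_gt _ cPhi 1 ltac:(by rewrite -[ltLHS]expR0 ltr_expR).
have H3 := cvgr_gt _ cS 0 A0.
have [n [[h1 h2] h3]] := filter_ex (filterI (filterI (H1 _) (H2 _)) (H3 _)).
pose a := T n / S n.
have [y0 [eta0 [y00 eta00 eta01 leaf]]] := leaf_prob mN mX mY mE Gind lawY lawE mu_pos.
pose I := ('I_n.+1 * 'I_(ncells n))%type.
pose p (z : I) : R := fine (P (hits N X (cell n) [::] z.1 z.2)).
pose v (z : I) : R := cell_low n z.2.
have p0 z : 0 <= p z by apply: fine_ge0; exact: measure_ge0.
have SE : \sum_z p z * expR (s * v z) = S n.
  by rewrite /S pair_bigA.
have TE : \sum_z p z * (v z * expR (s * v z)) = T n.
  by rewrite /T pair_bigA.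
have drift : \sum_z p z * (v z * expR (s * v z)) = a * \sum_z p z * expR (s * v z).
  by rewrite SE TE /a mulfVK// gt_eqF.
have mass : 1 < \sum_z p z * expR (s * (v z - a)).
  have -> : \sum_z p z * expR (s * (v z - a)) = S n * expR (- s * a).
    rewrite -SE mulr_suml; apply: eq_bigr => z _; rewrite -mulrA -expRD.
    by congr (_ * expR _); ring.
  exact: h2.
have [om [eta [K [om01 eta_le Meta super [om0 omK]]]]] :=
  supersolution n.+1 p0 drift mass eta00 eta01.
exists n, a, y0, K, (om (- K)); split => // m u.
have eta1 : eta <= 1 by exact: le_trans eta_le eta01.
have := @good_lower R d Omega P N X Y E mN mX mY mE laws Gind n.+1 (ncells n) (cell n)
  (cell_low n) y0 1 (@measurable_cell R n) (@trivIset_cell R n) om a eta om01 eta1 Meta.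
(* At this height the barrier is evaluated at -K whatever [m] is, so the bound does not depend on
   the depth. *)
move=> /(_ _ _ m u (a * m%:R - K)); rewrite addrAC subrr sub0r; apply.
- move=> z; apply: (le_trans (super z)).
  by rewrite [X in _ <= _ * X]pair_bigA.
- move=> {}u y /=; have [yle|ygt] := leP y 0; last by rewrite om0// measure_ge0.
  have -> : [set w | [/\ true, y0 <= Y u w & 0 < E u w <= 1]] =
      [set w | (y0 <= Y u w)%R /\ (0 < E u w <= 1)%R].
    by apply/seteqP; split => w /= [].
  apply: le_trans (leaf u); rewrite lee_fin (le_trans _ eta_le)//.
  by have /andP[] := om01 y.
Qed.

End GoodLinear.

(** * Independent trials along the line of first children *)

Section Spine.
Context {R : realType} {d : measure_display} {Omega : measurableType d}.
Variables (P : probability Omega R) (N : seq nat -> Omega -> nat)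
  (X : seq nat -> nat -> Omega -> R) (Y E : seq nat -> Omega -> R).
Hypothesis mN : forall u, measurable_fun setT (N u).
Hypothesis mX : forall u k, measurable_fun setT (X u k).
Hypothesis mY : forall u, measurable_fun setT (Y u).
Hypothesis mE : forall u, measurable_fun setT (E u).
Hypothesis laws : forall u, same_law P (pp_coords N X u) (pp_coords N X [::]).
Hypothesis Gind : mutually_independent P (marks N X Y E).

Local Notation G := (marks N X Y E).
Local Notation F := (sigma_of G).

(** If a second child almost surely never occurred, the mean offspring number would be at most 1.
    The position of the second child is bounded below by some -C with positive probability. *)
Lemma sibling_prob : (1 < laplace P N X 0)%E -> exists C p : R,
  [/\ 0 <= C, 0 < p, p <= 1 &
   forall u, P [set w | (1 < N u w)%N /\ - C <= X u 1%N w] = p%:E].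
Proof.
move=> L1.
have mA (n : nat) : measurable [set w | (1 < N [::] w)%N /\ - n%:R <= X [::] 1%N w].
  apply: measurableI; first exact: (measurable_N mN [::] [set m | (1 < m)%N]).
  suff : measurable [set w | - n%:R <= X [::] 1%N w] by [].
  rewrite (_ : [set w | _] = setT `&` X [::] 1%N @^-1` `[- n%:R, +oo[%classic).
    exact: mX.
  by rewrite setTI; apply/seteqP; split => w /=; rewrite in_itv/= andbT.
have m2 : measurable [set w | (1 < N [::] w)%N].
  exact: (measurable_N mN [::] [set m | (1 < m)%N]).
have [n hn] : exists n : nat, (0 < P [set w | (1 < N [::] w)%N /\ (- n%:R <= X [::] 1%N w)%R])%E.
  apply: measure_bigcup_gt0 => //.
  have -> : \bigcup_n [set w | (1 < N [::] w)%N /\ - n%:R <= X [::] 1%N w] =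
      [set w | (1 < N [::] w)%N].
    apply/seteqP; split => w /=; first by case=> n _ [].
    move=> N1; exists (Num.truncn (`|X [::] 1%N w|)).+1 => //; split => //.
    by rewrite lerNl (le_trans (ler_norm _))// normrN ltW// truncnS_gt.
  rewrite lt0e measure_ge0 andbT; apply/negP => /eqP P0.
  suff : (laplace P N X 0 <= 1)%E by rewrite leNgt L1.
  have mpsum : measurable_fun setT (fun w => (\sum_(i < N [::] w) expR (0 * X [::] i w))%:E).
    apply/measurable_EFinP.
    exact: (measurable_psum (mN [::]) (mX [::]) (measurable_expRM 0)).
  apply: (@le_trans _ _ (\int[P]_w 1)%E); last first.
    by rewrite integral_cst// mul1e; exact: probability_le1.
  apply: ae_ge0_le_integral => //.
  - by move=> w _; rewrite lee_fin sumr_ge0// => i _; exact: expR_ge0.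
  - exists [set w | (1 < N [::] w)%N]; split => // w /=; apply: contra_notP => /negP.
    rewrite -leqNgt => N1 _; under eq_bigr do rewrite mul0r expR0.
    by rewrite sumr_const card_ord lee_fin lern1.
pose p := fine (P [set w | (1 < N [::] w)%N /\ - n%:R <= X [::] 1%N w]).
have pE : P [set w | (1 < N [::] w)%N /\ - n%:R <= X [::] 1%N w] = p%:E.
  by rewrite fineK// fin_num_measure.
exists n%:R, p; split => //.
- by rewrite -lte_fin -pE.
- by rewrite -lee_fin -pE probability_le1.
- move=> u; rewrite -pE.
  have mI : measurable (`[- n%:R, +oo[%classic : set R) by exact: measurable_itv.
  have := same_law_cell laws u 1 [set m | (1 < m)%N] mI.
  have E' v : [set w | [set m | (1 < m)%N] (N v w) /\ `[- n%:R, +oo[%classic (X v 1%N w)] =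
      [set w | (1 < N v w)%N /\ - n%:R <= X v 1%N w].
    by apply/seteqP; split => w /=; rewrite in_itv/= andbT.
  by rewrite !E'.
Qed.

Variables (C p rho : R) (good : nat -> seq nat -> set Omega).
Hypothesis sibling : forall u, P [set w | (1 < N u w)%N /\ - C <= X u 1%N w] = p%:E.
Hypothesis p_gt0 : 0 < p.
Hypothesis p_le1 : p <= 1.
Hypothesis rho_gt0 : 0 < rho.
Hypothesis rho_le1 : rho <= 1.
Hypothesis good_sig : forall m u, F (subtree u) (good m u).
Hypothesis good_prob : forall m u, (rho%:E <= P (good m u))%E.

(** A trial at generation [i] of the spine: its vertex has a second child that is not too low, and
    below that child the remaining [n - i.+1] generations go well, so the path found ends in
    generation [n]. *)
Definition success n i : set Omega :=
  [set w | (1 < N (nseq i 0%N) w)%N /\ - C <= X (nseq i 0%N) 1%N w] `&`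
  good (n - i.+1) (rcons (nseq i 0%N) 1%N).

Fixpoint failure n j : set Omega :=
  if j is j'.+1 then failure n j' `&` ~` success n j' else setT.

(** The number of leading zeros of the vertex. The trial at spine level [i] only reads marks with
    exactly [i] of them, which makes trials at different levels independent. *)
Let leading (z : index) := find (fun k => k != 0%N) (vertex z).
Let level i : set index := [set z | leading z = i].
Let below j : set index := [set z | (leading z < j)%N].

Let sibling_sigma (W : set index) u : W (inl (inl u)) ->
  F W [set w | (1 < N u w)%N /\ - C <= X u 1%N w].
Proof.
move=> Wu.
have h1 : F W [set w | (1 < N u w)%N].
  have := @adapted_N _ _ _ N X Y E W u Wu measurableT [set m | (1 < m)%N] I.
  by rewrite setTI.
have h2 : F W (X u 1%N @^-1` `[- C, +oo[%classic).
  by have /adaptedP := @adapted_X _ _ _ N X Y E W u 1%N Wu; apply.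
rewrite (_ : [set w | _] = [set w | (1 < N u w)%N] `&` X u 1%N @^-1` `[- C, +oo[%classic).
  exact: (@measurableI _ (sigmaType N X Y E W) _ _ h1 h2).
by apply/seteqP; split => w /=; rewrite in_itv/= andbT.
Qed.

Let success_sigma n i : F (level i) (success n i).
Proof.
apply: (@measurableI _ (sigmaType N X Y E (level i))).
  apply: sibling_sigma.
  by rewrite /level/= /leading/= find_nseq mul1n.
apply: (sigma_ofS (W1 := subtree (rcons (nseq i 0%N) 1%N))); last exact: good_sig.
move=> z /prefixP[t zt]; rewrite /level/= /leading zt cat_rcons find_cat.
by rewrite has_nseq andbF/= size_nseq addn0.
Qed.

Let failure_sigma n j : F (below j) (failure n j).
Proof.
elim: j => [|j IH] /=; first exact: (@measurableT _ (sigmaType N X Y E (below 0))).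
have sub : below j `<=` below j.+1 by move=> z; rewrite /below/= => /leqW.
have sub' : level j `<=` below j.+1 by move=> z; rewrite /below /level/= => ->.
apply: (@measurableI _ (sigmaType N X Y E (below j.+1))); first exact: (sigma_ofS sub IH).
have sj : F (below j.+1) (success n j) := sigma_ofS sub' (@success_sigma n j).
exact: (@measurableC _ (sigmaType N X Y E (below j.+1)) _ sj).
Qed.

Lemma failure_measurable n j : measurable (failure n j).
Proof. by apply: (sigma_of_measurable (marks_measurable mN mX mY mE)); exact: failure_sigma. Qed.

Lemma success_prob n i : ((p * rho)%:E <= P (success n i))%E.
Proof.
rewrite /success (@indep_marks _ _ _ P N X Y E mN mX mY mE Gind
  [set z | z = inl (inl (nseq i 0%N))] (subtree (rcons (nseq i 0%N) 1%N)) _ _ _ _ _)//.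
- by rewrite sibling EFinM lee_wpmul2l ?good_prob// lee_fin ltW.
- by apply/seteqP; split => // z [-> /not_subtree_rcons]; exact.
- exact: sibling_sigma.
Qed.

Lemma failure_prob n j : (P (failure n j) <= ((1 - p * rho) ^+ j)%:E)%E.
Proof.
elim: j => [|j IH] /=; first by rewrite expr0 probability_setT.
have ms : measurable (success n j).
  by apply: (sigma_of_measurable (marks_measurable mN mX mY mE)); exact: success_sigma.
rewrite (@indep_marks _ _ _ P N X Y E mN mX mY mE Gind (below j) (level j)).
- rewrite exprSr EFinM lee_pmul// ?measure_ge0//.
  by rewrite probability_setC// EFinB leeB// success_prob.
- by apply/seteqP; split => // z []; rewrite /below /level /= => + zj; rewrite zj ltnn.
- exact: failure_sigma.
- exact: (@measurableC _ (sigmaType N X Y E (level j)) _ (@success_sigma n j)).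
Qed.

Lemma failure_exists n j w : ~ failure n j w -> exists2 i, (i < j)%N & success n i w.
Proof.
elim: j => [|j IH] /= nf; first by exfalso; apply: nf.
have [fj|/IH[i ij si]] := pselect (failure n j w); last by exists i => //; exact: leqW.
by exists j => //; apply: contrapT => ns; apply: nf.
Qed.

(** All of n/q independent trials fail with probability at most (1 - p rho)^(n/q), which is
    geometrically small in [n]. *)
Lemma ae_success q : (1 < q)%N ->
  {ae P, forall w, \forall n \near \oo, exists2 i, (i < n %/ q)%N & success n i w}.
Proof.
move=> q1; have q0 : 0 < q%:R :> R by rewrite ltr0n (ltn_trans _ q1).
pose t := p * rho; have t0 : 0 < t by rewrite mulr_gt0.
have t1 : t <= 1 by rewrite /t mulr_ile1// ltW.
have q2 : 2 <= q%:R :> R by rewrite ler_nat.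
have [x xE] : exists x, x = t / q%:R by exists (t / q%:R).
have qx : q%:R * x = t by rewrite xE mulrCA divff ?mulr1// gt_eqF.
have x0 : 0 < x by rewrite xE divr_gt0.
have x2 : x <= 1 / 2.
  have : 2 * x <= q%:R * x by rewrite ler_pM2r.
  by rewrite qx; lra.
pose r := 1 - x.
have r0 : 0 < r by rewrite /r; lra.
have r1 : r < 1 by rewrite /r; lra.
(* Bernoulli's inequality with x = t/q gives 1 - t <= r^q, which removes the integer division from
   the exponent without taking roots. *)
have bern (m : nat) : 1 - m%:R * x <= r ^+ m.
  elim: m => [|m IH]; first by rewrite mul0r subr0 expr0.
  rewrite exprS -natr1.
  have : r * (1 - m%:R * x) <= r * r ^+ m by rewrite ler_pM2l.
  have : 0 <= m%:R * x * x by rewrite !mulr_ge0// ltW.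
  by move: (m%:R) => m'; rewrite /r; nra.
have tr : 1 - t <= r ^+ q by have := bern q; rewrite qx.
(* The constant 1/r^q absorbs the remainder of the division. *)
have Pf n : (P (failure n (n %/ q)) <= ((r ^+ q)^-1 * r ^+ n)%:E)%E.
  have nq : (n <= q * (n %/ q) + q)%N.
    by rewrite {1}(divn_eq n q) mulnC leq_add2l ltnW// ltn_mod (ltn_trans _ q1).
  apply: (le_trans (failure_prob _ _)); rewrite lee_fin -/t.
  have h : (1 - t) ^+ (n %/ q) <= (r ^+ q) ^+ (n %/ q).
    by apply: lerXn2r => //; rewrite nnegrE ?subr_ge0//; apply: exprn_ge0; exact: ltW.
  apply: (le_trans h); rewrite mulrC ler_pdivlMr ?exprn_gt0//.
  by rewrite -exprM -exprD ler_wiXn2l ?ltW.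
have c0 : 0 <= (r ^+ q)^-1 by rewrite invr_ge0 exprn_ge0// ltW.
have := ae_eventually_not (fun n => @failure_measurable n (n %/ q)) c0 (ltW r0) r1 Pf.
by apply: filterS => w; apply: filterS => n /failure_exists.
Qed.

End Spine.

(** * The lower bound and the conclusion *)

Section LowerBound.
Context {R : realType} {d : measure_display} {Omega : measurableType d}.
Variables (P : probability Omega R) (N : seq nat -> Omega -> nat)
  (X : seq nat -> nat -> Omega -> R) (Y E : seq nat -> Omega -> R)
  (theta : R).
Hypothesis theta_gt0 : 0 < theta.

(** Concatenate the spine up to generation [i], the second child and the path given by
    [good_descends]; each piece gives one term of the bound. At the endpoint E <= 1, so Y/E is at
    least [y0]. *)
Lemma sibling_vertex (a y0 K C1 C2 : R) (n i m L : nat) (Cl : nat -> set R)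
    (v : nat -> R) w :
  0 < y0 -> (i < n)%N -> (forall j x, Cl j x -> v j <= x) ->
  (forall u, (0 < N u w)%N) ->
  - C1 <= displacement X w [::] (nseq i 0%N) ->
  success N X C2
    (fun m' u => good N X Y E m L Cl v y0 1 m' u (a * m'%:R - K)) n i w ->
  exists u, [/\ in_tree N w u, size u = n &
    a * (n - i.+1)%:R - K - C1 - C2 + theta^-1 * ln y0 <= pert_position theta X Y E w u].
Proof.
move=> y00 lin vC N0 hC1 [[N1 hC2] /(good_descends vC)[t [st dt yt hY /andP[E0 E1]]]].
have di : descends N w [::] (nseq i 0%N).
  by move=> j; rewrite size_nseq => ji; rewrite nth_nseq ji.
have du : descends N w [::] (nseq i 0%N ++ 1%N :: t).
  by apply: descends_cat => //; apply/descends_cons.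
exists (nseq i 0%N ++ 1%N :: t); split => //.
- by rewrite size_cat size_nseq /= st addnS -addSn subnKC.
- have -> : pert_position theta X Y E w (nseq i 0%N ++ 1%N :: t) =
      displacement X w [::] (nseq i 0%N ++ 1%N :: t) +
      theta^-1 * ln (Y (nseq i 0%N ++ 1%N :: t) w / E (nseq i 0%N ++ 1%N :: t) w) by [].
  rewrite displacement_cat displacement_cons /=.
  rewrite cat_rcons in hY E0 E1.
  have hln : theta^-1 * ln y0 <=
      theta^-1 * ln (Y (nseq i 0%N ++ 1%N :: t) w / E (nseq i 0%N ++ 1%N :: t) w).
    have Y0 := lt_le_trans y00 hY.
    rewrite ler_pM2l ?invr_gt0// ler_ln ?posrE//; last exact: divr_gt0.
    by rewrite ler_pdivlMr// (le_trans _ hY)// ler_piMr// ltW.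
  move: hln hC1 hC2 yt; set q1 := displacement _ _ _ _; set q2 := displacement _ _ _ _.
  by set q3 := theta^-1 * _; set q4 := theta^-1 * _; set q5 := a * _; lra.
Qed.

Lemma pert_lower (a a' y0 K C1 C2 : R) (m L : nat) (Cl : nat -> set R) (v : nat -> R) :
  0 < y0 -> (forall j x, Cl j x -> v j <= x) -> a' < a ->
  {ae P, forall w, forall u, (0 < N u w)%N} ->
  {ae P, forall w, \forall n \near \oo,
     - (C1 * n%:R) <= displacement X w [::] (nseq n 0%N)} ->
  (forall q, (1 < q)%N -> {ae P, forall w, \forall n \near \oo,
     exists2 i, (i < n %/ q)%N & success N X C2
      (fun m' u => good N X Y E m L Cl v y0 1 m' u (a * m'%:R - K)) n i w}) ->
  {ae P, forall w, \forall n \near \oo, exists u, [/\ in_tree N w u, size u = n &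
     a' * n%:R <= pert_position theta X Y E w u]}.
Proof.
move=> y00 vC aa' aeN aeC aeS.
(* One half of the slack a - a' pays for the generations spent on the spine, the other for the
   constants. *)
pose g := (a - a') / 2; have g0 : 0 < g by rewrite divr_gt0// subr_gt0.
pose D := `|a| + `|C1|; have D0 : 0 <= D by rewrite addr_ge0.
(* [D] bounds the loss per spine generation. Fewer than n/q of them precede the branching, so q >=
   D/g keeps the loss below g n; the successor taken twice also ensures q > 1. *)
pose q := (Num.truncn (D / g)).+2.
have qD : D <= g * q%:R.
  rewrite mulrC -ler_pdivrMr// ltW// (lt_trans (truncnS_gt _))// ltr_nat.
  exact: ltnSn.
apply: filterS3 aeN aeC (aeS q isT) => w N0 [n1 _ h1] Sw.
(* The linear bound on the spine holds only from [n1] on, whereas the branching level may be small;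
   [B] covers the earlier levels. *)
pose B := \sum_(i < n1) `|displacement X w [::] (nseq i 0%N)|.
have dB i : - (`|C1| * i%:R + B) <= displacement X w [::] (nseq i 0%N).
  have B0 : 0 <= B by apply: sumr_ge0.
  have [ni|ni] := leqP n1 i.
    apply: (le_trans _ (h1 i ni)).
    have : C1 * i%:R <= `|C1| * i%:R by rewrite ler_wpM2r// ler_norm.
    by lra.
  have : `|displacement X w [::] (nseq i 0%N)| <= B.
    by rewrite /B (bigD1 (Ordinal ni))//= lerDl sumr_ge0.
  have := ler_norm (- displacement X w [::] (nseq i 0%N)); rewrite normrN.
  have : 0 <= `|C1| * i%:R by rewrite mulr_ge0.
  by lra.
pose cst := K + B + C2 - theta^-1 * ln y0.
have ncst : \forall n \near \oo, cst <= g * n%:R.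
  exists (Num.truncn (cst / g)).+1 => // n /= hn.
  rewrite mulrC -ler_pdivrMr// ltW// (lt_le_trans (truncnS_gt _))// ler_nat.
  exact: hn.
apply: filterS2 Sw ncst => n [i iq si] hn.
have q0 : 0 < q%:R :> R by [].
have iqn : i.+1%:R * q%:R <= n%:R :> R.
  by rewrite -natrM ler_nat (leq_trans _ (leq_trunc_div n q))// leq_mul2r iq orbT.
have lin : (i < n)%N by rewrite (leq_trans iq)// leq_div.
have [u [Tu su hu]] := sibling_vertex y00 lin vC N0 (dB i) si.
exists u; split => //; apply: le_trans hu.
rewrite natrB//.
have Di : D * i.+1%:R <= g * n%:R.
  have : D * i.+1%:R <= g * q%:R * i.+1%:R by rewrite ler_wpM2r.
  have : g * (i.+1%:R * q%:R) <= g * n%:R by rewrite ler_pM2l.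
  by rewrite mulrCA mulrC => h h'; apply: le_trans h; rewrite mulrAC in h' *; lra.
have Ci : `|C1| * i%:R <= `|C1| * i.+1%:R by rewrite ler_wpM2l// ler_nat.
have ai : a * i.+1%:R <= `|a| * i.+1%:R by rewrite ler_wpM2r// ler_norm.
have ga : g * n%:R + g * n%:R = a * n%:R - a' * n%:R by rewrite /g; field.
move: hn Di Ci ai ga; rewrite /cst /D mulrDl mulrBr.
move: (g * n%:R) (a * n%:R) (a' * n%:R) (`|C1| * i%:R) (`|C1| * i.+1%:R).
by move: (a * i.+1%:R) (`|a| * i.+1%:R) (theta^-1 * ln y0) => *; lra.
Qed.

End LowerBound.

Theorem theorem2p2 (R : realType) (d : measure_display) (Omega : measurableType d)
  (P : probability Omega R)
  (N : seq nat -> Omega -> nat) (X : seq nat -> nat -> Omega -> R)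
  (Y E : seq nat -> Omega -> R) (mu : probability R R) (theta : R) :
  (* measurability *)
  (forall u, measurable_fun setT (N u)) ->
  (forall u k, measurable_fun setT (X u k)) ->
  (forall u, measurable_fun setT (Y u)) ->
  (forall u, measurable_fun setT (E u)) ->
  (* the point processes Z_u are copies of Z (= Z_root), with P(N = 0) = 0 *)
  (forall u, same_law P (pp_coords N X u) (pp_coords N X [::])) ->
  P [set w | N [::] w = 0%N] = 0%E ->
  (* nu finite on an open interval containing 0 *)
  (exists a b : R, a < 0 < b /\ forall t, a < t < b -> (laplace P N X t < +oo)%E) ->
  (* mu is a probability measure on (0, +oo), Y_u ~ mu, E_u ~ Exp(1) *)
  mu [set y | y <= 0] = 0%E ->
  (forall u B, measurable B -> P (Y u @^-1` B) = mu B) ->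
  (forall u B, measurable B -> P (E u @^-1` B) = exponential_prob 1 B) ->
  (* mutual independence of all Z_u, Y_u, E_u *)
  mutually_independent P (fun i : (seq nat + seq nat) + seq nat =>
    match i with
    | inl (inl u) => gen_sigma (pp_coords N X u)
    | inl (inr u) => gen_sigma (fun _ => Y u)
    | inr u => gen_sigma (fun _ => E u)
    end) ->
  (* theta_0 < oo, theta_0 > 0, 0 < theta, theta_0 <= theta *)
  theta0_set P N X !=set0 ->
  0 < theta0 P N X ->
  0 < theta ->
  theta0 P N X <= theta ->
  (* finite r-th moments of mu for r < theta_0 / theta *)
  (forall r : R, 0 < r < theta0 P N X / theta ->
     (\int[mu]_y (`|y| `^ r)%:E < +oo)%E) ->
  {ae P, forall w, (fun n : nat => Rstar theta N X Y E n w / n%:R) @ \oo -->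
                    nu P N X (theta0 P N X) / theta0 P N X}.
Proof.
move=> mN mX mY mE laws N_gt0 [lo [hi [/andP[lo0 hi0] fin]]] mu_pos lawY lawE Gind.
move=> set_neq0 t0_gt0 theta_gt0 t0_le moments.
have L0 : (laplace P N X 0 < +oo)%E by apply: fin; rewrite lo0.
have memS := theta0_mem (mN [::]) (mX [::]) N_gt0 L0 set_neq0 t0_gt0.
set x := nu _ _ _ _ / _.
have near := near_theta0 (mN [::]) (mX [::]) N_gt0 L0 set_neq0 t0_gt0.
have iexp s : 0 <= s -> s <= theta0 P N X -> psum_integrable P N X (fun y => expR (s * y)).
  exact: (pint_exp (mN [::]) (mX [::]) L0 memS).
have lap_fin s : (laplace P N X s < +oo)%E -> laplace P N X s = (fine (laplace P N X s))%:E.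
  move=> h; rewrite fineK// ge0_fin_numE//; apply: integral_ge0 => w _.
  by rewrite lee_fin sumr_ge0// => i _; exact: expR_ge0.
have upper e : 0 < e -> {ae P, forall w, \forall n \near \oo, forall v,
    in_tree N w v -> size v = n -> pert_position theta X Y E w v <= (x + e) * n%:R}.
  move=> e0; have [s [/andP[s0 st] h1 _ _]] := near _ e0.
  have is_ := iexp s (ltW s0) (ltW st).
  have La := lap_fin s ((laplaceE P (mN [::]) (mX [::]) s).2 is_).
  apply: (pert_upper mN mX mY mE laws Gind lawY lawE mu_pos theta_gt0 s0 _ _ La).
  - by rewrite ltr_pdivrMr// mul1r (lt_le_trans st).
  - by apply: moments; rewrite divr_gt0//= ltr_pM2r// invr_gt0.
  - rewrite -(expR_nu (mN [::]) N_gt0 is_) ltr_expR mulrC -ltr_pdivrMr//.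
have [C1 pathC] : exists C1, {ae P, forall w, \forall n \near \oo,
    - (C1 * n%:R) <= displacement X w [::] (nseq n 0%N)}.
  (* The transform is finite to the left of 0; half the left endpoint is an admissible negative
     exponent. *)
  have t0 : 0 < - (lo / 2) by lra.
  have Lt : (laplace P N X (- - (lo / 2)) < +oo)%E by apply: fin; rewrite opprK; apply/andP; split; lra.
  have La := lap_fin _ Lt; set aa := fine _ in La.
  have aa0 : 0 < aa.
    by apply: (laplace_gt0 (mN [::]) N_gt0); apply/(laplaceE P (mN [::]) (mX [::])).
  exists ((ln aa + 1) / - (lo / 2)).
  apply: (path_lower mN mX mY mE laws Gind N_gt0 t0 La).
  by rewrite mulrC mulfVK ?gt_eqF// -{1}[aa]lnK ?posrE// ltr_expR ltrDl.
have aeN := ae_offspring mN laws N_gt0.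
(* One [e] separates nu'(s) from x, the other the discretised drift [a] from nu'(s). *)
have lower e : 0 < e -> {ae P, forall w, \forall n \near \oo, exists u,
    [/\ in_tree N w u, size u = n & (x - e - e) * n%:R <= pert_position theta X Y E w u]}.
  move=> e0; have [s [/andP[s0 st] _ h2 h3]] := near _ e0.
  have ia := pint_abs (mN [::]) (mX [::]) L0 memS s0 (ltW st).
  have [m [a [y0 [K [rho [ha y00 rho0 hrho]]]]]] :=
    good_linear mN mX mY mE laws Gind lawY lawE mu_pos N_gt0 s0 (iexp s (ltW s0) (ltW st)) ia h3 e0.
  have L1 : (1 < laplace P N X 0)%E.
    rewrite (lap_fin _ L0) lte_fin.
    exact: (laplace0_gt1 (mN [::]) (mX [::]) N_gt0 L0 set_neq0 t0_gt0).
  have [C2 [p [_ p0 p1 sib]]] := sibling_prob mN mX laws L1.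
  have rho1 : rho <= 1.
    rewrite -lee_fin (le_trans (hrho 0%N [::]))// probability_le1//.
    by apply: good_measurable => // i; exact: measurable_cell.
  apply: (@pert_lower R d Omega P N X Y E theta theta_gt0 a _ y0 K C1 C2
    m.+1 (ncells m) (cell m) (cell_low m)) => //.
  - by move=> j z /cell_bounds/andP[].
  - by apply: lt_trans ha; rewrite ltrD2r.
  - move=> q q1; apply: (ae_success mN mX mY mE Gind sib p0 p1 rho0 rho1) => //.
    by move=> m' u; apply: good_sigma => // i; exact: measurable_cell.
(* Errors are taken along 1/(k+1), so that countably many null sets suffice. *)
have key : {ae P, forall w, forall k : nat, \forall n \near \oo,
    `|x - Rstar theta N X Y E n w / n%:R| <= k.+1%:R^-1 + k.+1%:R^-1}.
  apply: ae_foralln => k; have k0 : 0 < k.+1%:R^-1 :> R by rewrite invr_gt0.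
  apply: filterS2 (upper _ k0) (lower _ k0) => w Uw Lw.
  have n0 : \forall n \near \oo, (0 < n)%N by exact: nbhs_infty_gt.
  apply: filterS3 Uw Lw n0 => n Un [u [Tu su hu]] n_gt0.
  have nR : 0 < n%:R :> R by rewrite ltr0n.
  set S := [set pert_position theta X Y E w v | v in [set v | in_tree N w v /\ size v = n]].
  (* The real [sup] in [Rstar] is the true supremum only for a nonempty set bounded above: the lower
     bound supplies a member, the upper bound an upper bound. *)
  have Su : S (pert_position theta X Y E w u) by exists u.
  have ubS : ubound S ((x + k.+1%:R^-1) * n%:R) by move=> _ [v [Tv sv] <-]; exact: Un.
  have hub : Rstar theta N X Y E n w <= (x + k.+1%:R^-1) * n%:R.
    by apply: ge_sup => //; exists (pert_position theta X Y E w u).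
  have hlb : (x - k.+1%:R^-1 - k.+1%:R^-1) * n%:R <= Rstar theta N X Y E n w.
    by apply: (le_trans hu); apply: ub_le_sup => //; eexists; exact: ubS.
  rewrite -ler_pdivrMr// in hub *; rewrite -ler_pdivlMr// in hlb.
  move: hub hlb k0; set z := _ / n%:R; move: (k.+1%:R^-1) => e h1 h2 e0.
  by rewrite ler_norml; apply/andP; split; lra.
apply: filterS key => w hw; apply/cvgrPdist_le => e e0.
have e20 : 0 < e / 2 by rewrite divr_gt0.
have [k hk] := filter_ex (near_infty_natSinv_lt (PosNum e20)).
apply: filterS (hw k) => n /le_trans; apply; move: hk => /=.
by move: (k.+1%:R^-1) => f hk; lra.
Qed.
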